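(* Let $A\subset\mathbb{R}^d$ be a convex polytope with nonempty interior which is centrally symmetric and all of whose facets are centrally symmetric. Assume that there exists a positive, locally finite Borel measure $\mu$ on $\mathbb{R}^d$ such that $\mathbf{1}_A\ast\mu=\mathbf{1}_{A^c}$ almost everywhere, where $A^c=\mathbb{R}^d\setminus A$. Then each belt of $A$ consists of either $4$ or $6$ facets.
   Context: A set is centrally symmetric if $-A$ is a translate of $A$. A facet is a $(d-1)$-dimensional face; a subfacet is a $(d-2)$-dimensional face; each subfacet lies in exactly two facets. Belt: for a polytope with centrally symmetric facets, given a subfacet $G=F\cap F'$ of adjacent facets $F,F'$, reflect $G$ through the center of $F'$ to obtain a subfacet $G'$ of $F'$; $G'=F'\cap F''$ for another facet $F''$; continuing yields a cyclic sequence $F,F',F'',\dots,F^{(m)}=F$, the belt generated by $G$, in which consecutive facets meet in a translate of $G$ or $-G$. *)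

(* Defs.v *)
From HB Require Import structures.
From mathcomp Require Import all_boot all_order all_algebra.
From mathcomp Require Import all_classical all_reals all_analysis.
Import Order.TTheory GRing.Theory Num.Theory.
Import numFieldNormedType.Exports.

Set Implicit Arguments.
Unset Strict Implicit.
Unset Printing Implicit Defensive.

Local Open Scope classical_set_scope.
Local Open Scope ring_scope.

Notation borelRd R d := (g_sigma_algebraType (@open 'rV[R]_d)).

Section Defs.
Variables (R : realType) (d : nat).
Implicit Types (A S F : set 'rV[R]_d).

Definition dotv (u x : 'rV[R]_d) : R := \sum_(i < d) u ord0 i * x ord0 i.

Definition is_polytope A : Prop :=
  exists (n : nat) (p : 'I_n -> 'rV[R]_d),
    A = [set x | exists w : 'I_n -> R,
           (forall i, 0 <= w i) /\ \sum_(i < n) w i = 1 /\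
           x = \sum_(i < n) w i *: p i].

Definition centrally_symmetric S : Prop :=
  exists t : 'rV[R]_d, [set - x | x in S] = [set x + t | x in S].

Definition is_center (c : 'rV[R]_d) S : Prop :=
  forall x, S x <-> S (c *+ 2 - x).

Definition reflect_set (c : 'rV[R]_d) S : set 'rV[R]_d :=
  [set c *+ 2 - x | x in S].

Definition is_face A F : Prop :=
  F !=set0 /\
  exists u : 'rV[R]_d, u != 0 /\
    F = [set x | A x /\ forall y, A y -> dotv u y <= dotv u x].

Definition aff_indep (k : nat) (p : 'I_k.+1 -> 'rV[R]_d) : bool :=
  row_free (\matrix_(i < k) (p (lift ord0 i) - p ord0)).

Definition dim_ge S (k : nat) : Prop :=
  exists p : 'I_k.+1 -> 'rV[R]_d, (forall i, S (p i)) /\ aff_indep p.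

Definition has_dim S (k : nat) : Prop := dim_ge S k /\ ~ dim_ge S k.+1.

Definition facet A F : Prop := is_face A F /\ has_dim F d.-1.
Definition subfacet A G : Prop := is_face A G /\ has_dim G d.-2.

(* F : nat -> set is the (periodic continuation of the) belt generated by
   the subfacet F 0 `&` F 1 of the adjacent facets F 0, F 1 :
   the subfacet F i `&` F i.+1 is reflected through the center of F i.+1
   and F i.+2 is the other facet containing the reflected subfacet. *)
Definition belt_seq A (F : nat -> set 'rV[R]_d) : Prop :=
  (forall i, facet A (F i)) /\
  F 0%N <> F 1%N /\ subfacet A (F 0%N `&` F 1%N) /\
  forall i : nat, F i.+2 <> F i.+1 /\
    exists c, is_center c (F i.+1) /\
      F i.+1 `&` F i.+2 = reflect_set c (F i `&` F i.+1).

Definition box (a b : 'rV[R]_d) : set 'rV[R]_d :=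
  [set x | forall i, a ord0 i <= x ord0 i <= b ord0 i].
Definition box_vol (a b : 'rV[R]_d) : R := \prod_(i < d) (b ord0 i - a ord0 i).

Definition lebesgue_null (N : set 'rV[R]_d) : Prop :=
  forall eps : R, 0 < eps ->
    exists a b : nat -> 'rV[R]_d,
      (forall k i, a k ord0 i <= b k ord0 i) /\
      N `<=` \bigcup_k box (a k) (b k) /\
      forall n, \sum_(k < n) box_vol (a k) (b k) < eps.

Definition locally_finite (mu : {measure set (borelRd R d) -> \bar R}) : Prop :=
  forall K : set 'rV[R]_d, compact K -> (mu K < +oo)%E.

Definition conv_ind A (mu : {measure set (borelRd R d) -> \bar R})
    (x : 'rV[R]_d) : \bar R :=
  (\int[mu]_(y in setT) (\1_A (x - (y : 'rV[R]_d)))%:E)%E.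

Definition conv_tiles A (mu : {measure set (borelRd R d) -> \bar R}) : Prop :=
  lebesgue_null [set x | conv_ind A mu x <> (\1_(~` A) x)%:E].

End Defs.

(* Main.v *)
Require Import Defs.
From HB Require Import structures.
From mathcomp Require Import all_boot all_order all_algebra.
From mathcomp Require Import all_classical all_reals all_analysis.
From mathcomp Require Import measurable_realfun ring lra.
Import Order.TTheory GRing.Theory Num.Theory.
Import numFieldNormedType.Exports.
Local Open Scope classical_set_scope.
Local Open Scope ring_scope.

(** The belt lives in the plane W of the vectors orthogonal to its subfacets:
    projecting A along them gives a centrally symmetric polygon whose sides are
    the facets of the belt. Consecutive outer normals u_i turn in a constant
    direction by less than a half turn, and no antipode -u_j falls strictly
    between two of them. Hence the belt has 4 or 6 facets unless four consecutive
    normals u_i, ..., u_(i+3) lie in an open half plane, i.e. are positive on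
    some vector c.

    The latter contradicts the weak tiling. Blow up at a generic point x0 of the
    subfacet G = F_(i+1) /\ F_(i+2), along a direction a which points out of
    F_(i+1) and into F_(i+2). If A + t covers x0 and does not overlap A, then
    x0 - t is, up to the symmetry of A, in F_(i+1) or F_(i+2). Such translates covering
    x0 + s a and those covering x0 - s a form disjoint families, each of mass 1,
    as both points are outside A; but since c is positive on all the normals
    which can be active, all of them cover x0 + s c, so the mass 2 is at most 1.
    Adding to a and c a generic direction l of G makes the constraints of A that
    are not constant along G harmless. *)

Set Implicit Arguments.
Unset Strict Implicit.
Unset Printing Implicit Defensive.

(** * Bilinearity of the standard dot product *)

Section DotProduct.
Context {R : realType} {d : nat}.
Implicit Types u v w x y z : 'rV[R]_d.

Lemma dotvDr u x y : dotv u (x + y) = dotv u x + dotv u y.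
Proof. by rewrite /dotv -big_split; apply: eq_bigr => i _; rewrite !mxE mulrDr. Qed.

Lemma dotvZr u k x : dotv u (k *: x) = k * dotv u x.
Proof. by rewrite /dotv mulr_sumr; apply: eq_bigr => i _; rewrite !mxE mulrCA. Qed.

Lemma dotvC u x : dotv u x = dotv x u.
Proof. by apply: eq_bigr => i _; rewrite mulrC. Qed.

Lemma dotvNr u x : dotv u (- x) = - dotv u x.
Proof. by rewrite -scaleN1r dotvZr mulN1r. Qed.

Lemma dotvBr u x y : dotv u (x - y) = dotv u x - dotv u y.
Proof. by rewrite dotvDr dotvNr. Qed.

Lemma dotv0r u : dotv u 0 = 0.
Proof. by rewrite -(scale0r u) dotvZr mul0r. Qed.

Lemma dotvDl u v x : dotv (u + v) x = dotv u x + dotv v x.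
Proof. by rewrite !(dotvC _ x) dotvDr. Qed.

Lemma dotvZl u k x : dotv (k *: u) x = k * dotv u x.
Proof. by rewrite !(dotvC _ x) dotvZr. Qed.

Lemma dotvNl u x : dotv (- u) x = - dotv u x.
Proof. by rewrite !(dotvC _ x) dotvNr. Qed.

Lemma dotv0l x : dotv 0 x = 0.
Proof. by rewrite dotvC dotv0r. Qed.

Lemma dotvMnr u x n : dotv u (x *+ n) = dotv u x *+ n.
Proof. by rewrite -scaler_nat dotvZr mulr_natl. Qed.

Lemma dotv_sumr u (I : Type) (r : seq I) (P : pred I) (f : I -> 'rV[R]_d) :
  dotv u (\sum_(i <- r | P i) f i) = \sum_(i <- r | P i) dotv u (f i).
Proof. by elim/big_rec2: _ => [|i y1 y2 _ <-]; rewrite ?dotv0r ?dotvDr. Qed.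

Lemma dotv_gt0 u : u != 0 -> 0 < dotv u u.
Proof.
move=> u0; have h i : true -> 0 <= u ord0 i * u ord0 i by rewrite -expr2 sqr_ge0.
rewrite lt_def sumr_ge0// andbT; apply: contra u0 => /eqP e.
apply/eqP/rowP => i; rewrite mxE.
have : u ord0 i * u ord0 i = 0 by apply: (psumr_eq0P h e).
by move/eqP; rewrite -expr2 sqrf_eq0 => /eqP.
Qed.

Lemma dotvE u x : u *m x^T = (dotv u x)%:M.
Proof.
apply/rowP => i; rewrite !mxE (ord1 i) eqxx mulr1n.
by apply: eq_bigr => j _; rewrite mxE.
Qed.

End DotProduct.

(** * Finitely generated cones are polyhedral *)

Section Weyl.
Context {R : realType} {d : nat}.
Implicit Types p x : 'rV[R]_d.

Lemma exists_ge0_between (l m : seq R) :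
  (forall y, y \in m -> 0 <= y) ->
  (forall x y : R, x \in l -> y \in m -> x <= y) ->
  exists w : R, [/\ 0 <= w, forall x : R, x \in l -> x <= w & forall y : R, y \in m -> w <= y].
Proof.
move=> m0 lm; exists (\big[Num.max/0]_(x <- l) x); split.
- exact: bigmax_ge_id.
- by move=> x xl; apply: (le_bigmax_seq 0 x).
- move=> y ym; rewrite big_seq; apply: bigmax_le; first exact: m0.
  by move=> i il; apply: lm.
Qed.

(* Fourier-Motzkin elimination of the coefficient w of the new generator p. *)
Lemma fourier_motzkin (us : seq 'rV[R]_d) p :
  exists us' : seq 'rV[R]_d, forall x,
    (exists2 w, 0 <= w & {in us, forall u, dotv u (x - w *: p) <= 0}) <->
    {in us', forall u, dotv u x <= 0}.
Proof.
pose neg := [seq u <- us | dotv u p <= 0].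
pose pos := [seq u <- us | 0 < dotv u p].
(* These are nonnegative combinations of one member of [pos] and one of [neg] that vanish on [p], so
   their constraints no longer involve [w]. *)
pose mix := [seq dotv z.1 p *: z.2 - dotv z.2 p *: z.1 |
              z <- [seq (x, y) | x <- pos, y <- neg]].
exists (neg ++ mix) => x; split.
  move=> [w w0 h] u; rewrite mem_cat => /orP[|/mapP[z /allpairsP[[u1 u2] /=]]].
    rewrite mem_filter => /andP[up /h]; rewrite dotvBr dotvZr.
    by have := mulr_ge0_le0 w0 up; lra.
  rewrite !mem_filter => -[/andP[p1 /h h1] /andP[p2 /h h2] ->] -> /=.
  rewrite dotvDl dotvNl !dotvZl.
  move: h1 h2; rewrite !dotvBr !dotvZr => h1 h2.
  by nra.
move=> h.
have hneg u : u \in us -> dotv u p <= 0 -> dotv u x <= 0.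
  by move=> uu up; apply: h; rewrite mem_cat mem_filter up uu.
have hmix u1 u2 : u1 \in us -> u2 \in us -> 0 < dotv u1 p -> dotv u2 p <= 0 ->
    dotv u1 p * dotv u2 x <= dotv u2 p * dotv u1 x.
  move=> u1u u2u p1 p2; rewrite -subr_le0.
  have := h (dotv u1 p *: u2 - dotv u2 p *: u1).
  rewrite dotvDl dotvNl !dotvZl; apply.
  rewrite mem_cat; apply/orP; right; apply/mapP; exists (u1, u2) => //.
  by apply/allpairsP; exists (u1, u2); rewrite !mem_filter p1 p2 u1u u2u.
have [||w [w0 wl wm]] := @exists_ge0_between
  [seq dotv u x / dotv u p | u <- pos]
  [seq dotv u x / dotv u p | u <- us & dotv u p < 0].
- move=> y /mapP[u]; rewrite mem_filter => /andP[up uu] ->.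
  by rewrite -mulrNN -invrN mulr_ge0 ?oppr_ge0 ?invr_ge0 ?hneg ?ltW ?oppr_gt0.
- move=> y1 y2 /mapP[u1]; rewrite mem_filter => /andP[p1 uu1] ->.
  move=> /mapP[u2]; rewrite mem_filter => /andP[p2 uu2] ->.
  rewrite ler_pdivrMr// mulrAC ler_ndivlMr//.
  by have := hmix _ _ uu1 uu2 p1 (ltW p2); lra.
exists w => // u uu; rewrite dotvBr dotvZr subr_le0.
case: (ltgtP (dotv u p) 0) => up.
- have : w <= dotv u x / dotv u p.
    by apply: wm; apply/mapP; exists u => //; rewrite mem_filter up uu.
  by rewrite ler_ndivlMr.
- have : dotv u x / dotv u p <= w.
    by apply: wl; apply/mapP; exists u => //; rewrite mem_filter up uu.
  by rewrite ler_pdivrMr.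
- by rewrite up mulr0 hneg ?up.
Qed.

(** Induction on the number of generators: the zero cone is cut out by the signed coordinates, and
    each further generator costs one elimination. *)
Lemma weyl n (p : 'I_n -> 'rV[R]_d) :
  exists us : seq 'rV[R]_d, forall x,
    (exists w : 'I_n -> R, (forall i, 0 <= w i) /\ x = \sum_i w i *: p i) <->
    {in us, forall u, dotv u x <= 0}.
Proof.
elim: n p => [|n IH] p.
  exists ([seq delta_mx ord0 i | i <- enum 'I_d] ++ [seq - delta_mx ord0 i | i <- enum 'I_d]) => x.
  have dE (i : 'I_d) : dotv (delta_mx ord0 i) x = x ord0 i.
    rewrite /dotv (bigD1 i)//= big1 ?addr0 => [|j ji]; rewrite !mxE ?eqxx ?mul1r//.
    by rewrite (negbTE ji) mul0r.
  split=> [[w [_ ->]] u _|h]; first by rewrite big_ord0 dotv0r.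
  exists (fun=> 0); split=> //; rewrite big_ord0; apply/rowP => i; rewrite mxE.
  apply/le_anti/andP; split.
    by rewrite -dE; apply: h; rewrite mem_cat map_f ?mem_enum.
  rewrite -oppr_le0 -dE -dotvNl; apply: h.
  by rewrite mem_cat orbC (map_f (fun i => - delta_mx ord0 i)) ?mem_enum.
have [us hus] := IH (fun i => p (lift ord0 i)).
have [us' hus'] := fourier_motzkin us (p ord0).
exists us' => x; rewrite -hus'; split.
  move=> [w [w0 ->]]; exists (w ord0) => //.
  apply/hus; exists (fun i => w (lift ord0 i)); split=> //.
  by rewrite big_ord_recl addrAC subrr add0r.
move=> [w0 w00 /hus[w [wge e]]].
exists (fun i => if unlift ord0 i is Some j then w j else w0); split.
  by move=> i; case: unliftP.
rewrite big_ord_recl unlift_none; under eq_bigr do rewrite liftK.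
by rewrite -e addrCA subrr addr0.
Qed.

End Weyl.

(** * Polytopes as intersections of half-spaces *)

Lemma sum_row_mx {V : nmodType} {m n : nat} (I : Type) (r : seq I)
    (a : I -> 'rV[V]_m) (b : I -> 'rV[V]_n) :
  \sum_(i <- r) row_mx (a i) (b i) = row_mx (\sum_(i <- r) a i) (\sum_(i <- r) b i).
Proof.
elim: r => [|i r IH]; first by rewrite !big_nil row_mx0.
by rewrite !big_cons IH add_row_mx.
Qed.

Definition hrep {R : realType} {d N : nat} (v : 'I_N -> 'rV[R]_d) (h : 'I_N -> R) :
  set 'rV[R]_d := [set x | forall j, dotv (v j) x <= h j].

Lemma polytope_hrep {R : realType} {d : nat} (A : set 'rV[R]_d) :
  is_polytope A -> A !=set0 ->
  exists N (v : 'I_N -> 'rV[R]_d) (h : 'I_N -> R),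
    (forall j, v j != 0) /\ A = hrep v h.
Proof.
move=> [n [p AE]] [x0 Ax0].
have [us hus] := weyl (fun i => row_mx (p i) (1%:M : 'rV[R]_1)).
pose vs := [seq u <- us | lsubmx u != 0].
have dE (u : 'rV[R]_(d + 1)) (x : 'rV[R]_d) : dotv u (row_mx x 1%:M) =
    dotv (lsubmx u) x + rsubmx u ord0 ord0.
  rewrite /dotv big_split_ord /= big_ord1 row_mxEr !mxE eqxx mulr1; congr (_ + _).
  by apply: eq_bigr => i _; rewrite row_mxEl mxE.
have AP x : A x <-> {in us, forall u, dotv u (row_mx x (1%:M : 'rV[R]_1)) <= 0}.
  rewrite -hus AE /=; split=> -[w [w0]].
    move=> [w1 ->]; exists w; split=> //.
    under [RHS]eq_bigr do rewrite scale_row_mx.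
    rewrite sum_row_mx; congr row_mx.
    by rewrite -scaler_suml w1 scale1r.
  under eq_bigr do rewrite scale_row_mx.
  rewrite sum_row_mx => /eq_row_mx[-> e]; exists w; split=> //; split=> //.
  by move: e; rewrite -scaler_suml => /matrixP/(_ ord0 ord0); rewrite !mxE eqxx mulr1.
exists (size vs), (fun j => lsubmx (tnth (in_tuple vs) j)),
  (fun j => - rsubmx (tnth (in_tuple vs) j) ord0 ord0); split.
  by move=> j; have := mem_tnth j (in_tuple vs); rewrite mem_filter => /andP[].
apply/seteqP; split=> x.
  move=> /AP h j; have := mem_tnth j (in_tuple vs).
  by rewrite mem_filter => /andP[_ /h]; rewrite dE; lra.
move=> h; apply/AP => u uu; rewrite dE.
have [u0|u0] := eqVneq (lsubmx u) 0.
  by move/AP: Ax0 => /(_ _ uu); rewrite dE u0 !dotv0l.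
have : u \in in_tuple vs by rewrite mem_filter u0 uu.
by move=> /tnthP[j ->]; have := h j; lra.
Qed.

Lemma polytope_bounded {R : realType} {d : nat} (A : set 'rV[R]_d) :
  is_polytope A -> exists r, forall x, A x -> forall i, `|x ord0 i| <= r.
Proof.
move=> [n [p ->]]; exists (\sum_k \sum_i `|p k ord0 i|) => x [w [w0 [w1 ->]]] i.
have wle k : w k <= 1 by rewrite -w1 (bigD1 k)//= lerDl sumr_ge0.
rewrite summxE; apply: le_trans (ler_norm_sum _ _ _) _.
apply: ler_sum => k _; rewrite mxE normrM ger0_norm// (bigD1 i)//=.
rewrite -[leLHS]addr0; apply: lerD; last by apply: sumr_ge0.
by rewrite ler_piMl.
Qed.

(** * Rank arguments *)

Section Rank.
Context {F : fieldType} {d : nat}.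

Lemma kermx_tr_sub1 {k} (M : 'M[F]_(k, d)) (u : 'rV_d) :
  (u <= kermx M^T)%MS = (M *m u^T == 0).
Proof. by rewrite sub_kermx -[M *m _]trmxK trmx_mul trmxK trmx_eq0. Qed.

(** The annihilator of [d.-1] independent vectors is at most a line. *)
Lemma parallel_of_corank1 (M : 'M[F]_(d.-1, d)) (u w : 'rV_d) :
  row_free M -> u != 0 -> M *m u^T = 0 -> M *m w^T = 0 -> exists k, w = k *: u.
Proof.
move=> fM u0 /eqP; rewrite -kermx_tr_sub1 => uK /eqP; rewrite -kermx_tr_sub1 => wK.
apply/sub_rVP; apply: submx_trans wK _.
have := mxrank_leqif_sup uK => -[_ <-].
rewrite mxrank_ker mxrank_tr (eqP fM) rank_rV u0.
have d0 : (0 < d)%N.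
  rewrite lt0n; apply: contra u0 => /eqP d0; apply/eqP/rowP => i.
  by have := ltn_ord i; rewrite [X in (_ < X)%N]d0.
by rewrite -{1}(prednK d0) subSnn.
Qed.

(** The annihilator of [d.-2] independent vectors has dimension at most 2, so two non-proportional
    members span it. *)
Lemma span_of_corank2 (M : 'M[F]_(d.-2, d)) (u u' w : 'rV_d) :
  row_free M -> u != 0 -> ~ (exists k, u' = k *: u) ->
  M *m u^T = 0 -> M *m u'^T = 0 -> M *m w^T = 0 ->
  exists a b, w = a *: u + b *: u'.
Proof.
move=> fM u0 nu /eqP; rewrite -kermx_tr_sub1 => uK /eqP; rewrite -kermx_tr_sub1 => u'K.
move=> /eqP; rewrite -kermx_tr_sub1 => wK.
have /sub_addsmxP[[x y] /= ->] : (w <= u + u')%MS.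
  apply: submx_trans wK _.
  have uuK : (u + u' <= kermx M^T)%MS by rewrite addsmx_sub uK.
  have := mxrank_leqif_sup uuK => -[uule <-].
  rewrite eqn_leq uule /=.
  have : (u < u + u')%MS.
    rewrite /ltmx addsmxSl /= addsmx_sub submx_refl /=.
    by apply/negP => /sub_rVP.
  rewrite ltmxErank => /andP[_]; rewrite rank_rV u0 => r2.
  apply: leq_trans r2.
  rewrite mxrank_ker mxrank_tr (eqP fM).
  by case: (d) => [|[|n]] //=; rewrite leq_subLR addnC.
exists (x ord0 ord0), (y ord0 ord0).
by rewrite [x in LHS]mx11_scalar [y in LHS]mx11_scalar !mul_scalar_mx.
Qed.

End Rank.

(** The product of the [q i] has finitely many roots, so one of sufficiently many natural numbers
    avoids them all. This serves to choose a direction in general position. *)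
Lemma exists_nonroots {R : realType} (I : finType) (P : pred I) (q : I -> {poly R}) :
  (forall i, P i -> q i != 0) -> exists x, forall i, P i -> (q i).[x] != 0.
Proof.
move=> q0; pose p := \prod_(i | P i) q i.
have p0 : p != 0 by apply/prodf_neq0.
have : ~~ all (root p) [seq i%:R | i <- iota 0 (size p)].
  apply/negP => /(max_poly_roots p0); rewrite size_map size_iota ltnn.
  suff -> : uniq [seq i%:R : R | i <- iota 0 (size p)] by move/(_ isT).
  by rewrite map_inj_uniq ?iota_uniq// => i j /eqP; rewrite eqr_nat => /eqP.
move=> /allPn[x _]; rewrite /root horner_prod => /prodf_neq0 h.
by exists x.
Qed.

Section RowNorm.
Context {R : realType} {d : nat}.
Implicit Types x : 'rV[R]_d.

Lemma norm_le_coord x r : 0 <= r -> (forall i, `|x ord0 i| <= r) -> `|x| <= r.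
Proof.
move=> r0 xr; rewrite [leLHS]/Num.norm /= mx_normrE; apply/bigmax_leP.
by split=> // -[i j] _ /=; rewrite (ord1 i).
Qed.

Lemma dotv_continuous (u : 'rV[R]_d) : continuous (dotv u).
Proof.
rewrite /dotv; apply: continuous_big => [|i _ x]; first exact: add_continuous.
by apply: continuousM; [exact: cst_continuous|exact: coord_continuous].
Qed.

End RowNorm.

(** * Complements of null sets are dense *)

Section BoxCover.
Context {R : realType}.

(* The weights [c k] make the induction on the dimension go through: fixing the
   last coordinate y multiplies them by the indicators of [a k n, b k n] at y. *)
Lemma weighted_box_cover n (lo : nat -> R) (r : R) (a b : nat -> nat -> R) (c : nat -> R) :
  0 < r -> (forall k, 0 <= c k) -> (forall k i, a k i <= b k i) ->
  (forall x : nat -> R, (forall i, (i < n)%N -> lo i <= x i <= lo i + r) ->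
    (1 <= \sum_(k <oo) (c k * \prod_(i < n) ((a k i <= x i <= b k i)%R : bool)%:R)%:E)%E) ->
  ((r ^+ n)%:E <= \sum_(k <oo) (c k * \prod_(i < n) (b k i - a k i))%:E)%E.
Proof.
move=> r0; elim: n c => [|n IH] c c0 ab cov.
  have := cov (fun=> 0) (fun i => ltac:(by [])).
  rewrite expr0 => /le_trans; apply; rewrite le_eqVlt; apply/orP; left; apply/eqP.
  by apply: eq_eseriesr => k _; rewrite !big_ord0.
pose V k := c k * \prod_(i < n) (b k i - a k i).
have V0 k : 0 <= V k.
  by rewrite mulr_ge0// prodr_ge0// => i _; rewrite subr_ge0.
pose f k (y : R) := ((V k)%:E * (\1_(`[a k n, b k n]%classic : set (R)) y)%:E)%E.
have f0 k y : (0 <= f k y)%E by rewrite mule_ge0// lee_fin.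
have mf k : measurable_fun (`[lo n, lo n + r]%classic : set (R)) (f k).
  apply: measurable_funeM; apply/measurable_EFinP.
  by apply: measurable_indic; apply: measurable_itv.
have slice (y : R) : `[lo n, lo n + r]%classic y ->
    ((r ^+ n)%:E <= \sum_(k <oo) f k y)%E.
  move=> /=; rewrite in_itv /= => ylo.
  have -> : (\sum_(k <oo) f k y)%E =
      (\sum_(k <oo) ((c k * ((a k n <= y <= b k n)%R : bool)%:R) *
         \prod_(i < n) (b k i - a k i))%:E)%E.
    apply: eq_eseriesr => k _; rewrite /f -EFinM /V indicE.
    by rewrite mem_setE in_itv /= mulrAC.
  apply: IH => // [k|x xlo]; first by rewrite mulr_ge0.
  pose x' i := if i == n then y else x i.
  have : forall i, (i < n.+1)%N -> lo i <= x' i <= lo i + r.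
    move=> i; rewrite ltnS /x'; case: eqVneq => [->//|ni] ilen.
    by apply: xlo; rewrite ltn_neqAle ni.
  move=> /(cov x')/le_trans; apply; rewrite le_eqVlt; apply/orP; left; apply/eqP.
  apply: eq_eseriesr => k _; rewrite big_ord_recr /= -[in RHS]mulrA.
  have -> : x' n = y by rewrite /x' eqxx.
  congr (_ * _)%:E; rewrite [RHS]mulrC; congr (_ * _).
  by apply: eq_bigr => i _; rewrite /x' ltn_eqF.
pose D := `[lo n, lo n + r]%classic : set R.
have mD : measurable D by exact: measurable_itv.
(* Integrating [slice] over the last coordinate and exchanging sum and integral turns each indicator
   into at most the length [b k n - a k n]. *)
have : (\int[@lebesgue_measure R]_(y in D) (r ^+ n)%:E <=
    \int[@lebesgue_measure R]_(y in D) (\sum_(k <oo) f k y))%E.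
  apply: ge0_le_integral => //.
  - by move=> y _; rewrite lee_fin exprn_ge0// ltW.
  - by apply: (ge0_emeasurable_sum (P := xpredT)) => [k y _ _|k _]; [exact: f0|exact: mf].
rewrite integral_cst /D//= lebesgue_measure_itv /= lte_fin ltrDl r0.
rewrite -EFinD addrAC subrr add0r -EFinM -exprSr => /le_trans; apply.
rewrite integral_nneseries//.
apply: lee_nneseries => [k _ _|k _]; first by apply: integral_ge0.
rewrite /f ge0_integralZl//=; last 2 first.
- by apply/measurable_EFinP; apply: measurable_indic; apply: measurable_itv.
- by rewrite lee_fin.
rewrite integral_indic//= big_ord_recr /= mulrA -/(V k) [X in (_ <= X)%E]EFinM.
apply: lee_wpmul2l; first by rewrite lee_fin.
have -> : ((b k n - a k n)%:E = lebesgue_measure (`[a k n, b k n]%classic : set R))%E.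
  rewrite lebesgue_measure_itv /= lte_fin EFinB.
  case: ltP => // ba; have -> : b k n = a k n by apply/le_anti; rewrite ba ab.
  by rewrite subee.
by apply: le_measure; rewrite ?inE//; apply: measurableI.
Qed.

(** If [S] contained the ball, boxes of total volume below [r ^+ d / 2] would cover the cube of side
    [r] centred at [x], against [weighted_box_cover] with unit weights. *)
Lemma lebesgue_null_codense {d} (S : set 'rV[R]_d) (x : 'rV[R]_d) (r : R) :
  lebesgue_null S -> 0 < r -> exists2 y, `|y - x| < r & ~ S y.
Proof.
move=> S0 r0; apply: contrapT => /forall2NP nS.
have {}nS y : `|y - x| < r -> S y.
  by move=> yx; case: (nS y) => // /contrapT.
have e0 : 0 < r ^+ d / 2 by rewrite divr_gt0// exprn_gt0.
have [a [b [ab [cov vol]]]] := S0 _ e0.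
pose ext (w : 'rV[R]_d) (i : nat) := if insub i is Some j then w ord0 j else 0.
have extE w (i : 'I_d) : ext w i = w ord0 i by rewrite /ext valK.
have := @weighted_box_cover d (fun i => ext x i - r / 2) r
  (fun k => ext (a k)) (fun k => ext (b k)) (fun=> 1) r0 (fun=> ler01).
have -> : (\sum_(k <oo) (1 * \prod_(i < d) (ext (b k) i - ext (a k) i))%:E =
          \sum_(k <oo) (box_vol (a k) (b k))%:E)%E.
  apply: eq_eseriesr => k _; rewrite mul1r; congr EFin.
  by apply: eq_bigr => i _; rewrite !extE.
move=> h.
have : ((r ^+ d)%:E <= (r ^+ d / 2)%:E)%E.
  apply: (le_trans (h _ _)).
  - by move=> k i; rewrite /ext; case: insubP => // j _ _; apply: ab.
  - move=> y yc; pose z : 'rV[R]_d := \row_i y i.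
    have [|k _ kz] := cov z.
      apply: nS; rewrite -normrN opprB; apply: le_lt_trans (_ : r / 2 < r); last by lra.
      apply: norm_le_coord => [|j]; first by lra.
      rewrite !mxE ler_norml.
      by have := yc j (ltn_ord j); rewrite extE; lra.
    apply: le_trans (nneseries_lim_ge k.+1 _).
      rewrite big_mkord big_ord_recr /= -[X in (X <= _)%E]add0e.
      apply: leeD; first by apply: sume_ge0 => i _; rewrite lee_fin mul1r prodr_ge0.
      rewrite mul1r lee_fin big1// => i _.
      by rewrite !extE; have := kz i; rewrite mxE => ->.
    by move=> i _ _; rewrite lee_fin mul1r prodr_ge0.
  - apply: lime_le.
      apply: is_cvg_nneseries => k _ _; rewrite lee_fin prodr_ge0// => i _.
      by rewrite subr_ge0 ab.
    by apply: nearW => n; rewrite sumEFin lee_fin big_mkord ltW.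
by rewrite lee_fin; have := exprn_gt0 d r0; lra.
Qed.

End BoxCover.

(** * The mass of the translates covering a point *)

Section Translates.
Context {R : realType} {d : nat}.
Implicit Types (A U S : set 'rV[R]_d) (x t : 'rV[R]_d).
Variable mu : {measure set (borelRd R d) -> \bar R}.

Lemma open_borel U : open U -> measurable (U : set (borelRd R d)).
Proof. by move=> oU; apply: sub_sigma_algebra. Qed.

Lemma closed_borel U : closed U -> measurable (U : set (borelRd R d)).
Proof. by move=> /closed_openC oU; rewrite -[U]setCK; apply: measurableC; apply: open_borel. Qed.

Definition covers A x : set 'rV[R]_d := [set t | A (x - t)].

Lemma closed_covers A x : closed A -> closed (covers A x).
Proof.
move=> cA; apply: (@closed_comp _ _ (fun t => x - t)) => // t _.
by apply: (@continuousB _ _ _ (cst x) id); [exact: cst_continuous|exact: cvg_id].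
Qed.

Lemma conv_indE A x : closed A -> conv_ind A mu x = mu (covers A x).
Proof.
move=> cA; rewrite /conv_ind -[RHS](_ : \int[mu]_(y in setT) (\1_(covers A x) y)%:E = _)%E.
  by apply: eq_integral.
rewrite integral_indic ?setIT//.
  by apply: closed_borel; apply: closed_covers.
Qed.

Definition exact_at A x : Prop := mu (covers A x) = (\1_(~` A) x)%:E.

Lemma exact_at_in A x : exact_at A x -> A x -> mu (covers A x) = 0%E.
Proof. by move=> -> Ax; rewrite indicE memNset//=; apply. Qed.

Lemma exact_at_out A x : exact_at A x -> ~ A x -> mu (covers A x) = 1%E.
Proof. by move=> -> Ax; rewrite indicE mem_set. Qed.

Lemma exact_at_le1 A x : exact_at A x -> (mu (covers A x) <= 1)%E.
Proof. by move=> ->; rewrite lee_fin indicE; case: (_ \in _). Qed.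

Lemma exact_at_dense A x (r : R) : closed A -> conv_tiles A mu -> 0 < r ->
  exists2 y, `|y - x| < r & exact_at A y.
Proof.
move=> cA tA r0; have [y yx /contrapT yA] := lebesgue_null_codense x tA r0.
by exists y; rewrite // /exact_at -conv_indE.
Qed.

(** The translates covering an exact point of [A] have mass zero. Countably many such points
    suffice: each [t] in [U] has a whole ball common to [A] and [A + t], and exact points are
    dense. *)
Lemma mu_interior_diff0 A U : closed A -> conv_tiles A mu -> open U ->
  (forall t, U t -> exists x (r : R), 0 < r /\
     forall y, `|y - x| < r -> A y /\ A (y - t)) ->
  mu U = 0%E.
Proof.
move=> cA tA oU hU.
pose q (k : nat) : 'rV[R]_d :=
  if (unpickle k : option ('rV[rat]_d * nat)) is Some (w, _) then map_mx ratr w else 0.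
pose e (k : nat) : R :=
  if (unpickle k : option ('rV[rat]_d * nat)) is Some (_, m) then m.+1%:R^-1 else 1.
have e0 k : 0 < e k.
  by rewrite /e; case: unpickle => [[_ m]|] //; rewrite invr_gt0.
have /choice[g hg] : forall k, exists y, `|y - q k| < e k /\ exact_at A y.
  by move=> k; have [y] := exact_at_dense (q k) cA tA (e0 k); exists y.
pose C k := if asbool (A (g k)) then covers A (g k) else set0.
apply/negligibleP; first exact: open_borel.
apply: (@negligibleS _ _ _ mu (\bigcup_k (C k : set (borelRd R d)))); last first.
  apply: negligible_bigcup => k; rewrite /C; case: asboolP => [Ag|_].
    exists (covers A (g k)); split=> //; first by apply: closed_borel; apply: closed_covers.
    by apply: exact_at_in => //; case: (hg k).
  exact: negligible_set0.
move=> t /hU[x [r [r0 hx]]].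
pose m := Num.truncn (2 / r).
have mr : m.+1%:R^-1 < r / 2 :> R.
  rewrite -[ltRHS]invrK invf_div ltf_pV2 ?posrE ?divr_gt0//.
  exact: truncnS_gt.
have /choice[w hw] : forall i : 'I_d, exists c : rat,
    x ord0 i - r / 2 < ratr c < x ord0 i.
  move=> i; have [|c] := @rat_in_itvoo R (x ord0 i - r / 2) (x ord0 i); first by lra.
  by rewrite in_itv /= => h; exists c.
pose k := pickle (\row_i w i, m).
pose z : 'rV[R]_d := map_mx ratr (\row_i w i).
have gz : `|g k - z| < m.+1%:R^-1.
  by have [+ _] := hg k; rewrite /q /e /k pickleK.
have zx : `|z - x| <= r / 2.
  apply: norm_le_coord => [|i]; first by lra.
  by rewrite !mxE ler_norml; have := hw i; lra.
have gx : `|g k - x| < r.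
  have := ler_normD (g k - z) (z - x); rewrite addrA subrK => /le_lt_trans; apply.
  by rewrite [ltRHS]splitr; apply: ltr_leD => //; apply: lt_trans mr.
by have [Ag Agt] := hx _ gx; exists k; rewrite // /C asboolT.
Qed.

(* Continuity of mu from above. *)
Lemma mu_near_hyperplanes (K : set 'rV[R]_d) N (f : 'I_N -> 'rV[R]_d -> R) (C e : R) :
  locally_finite mu -> compact K -> (forall j, continuous (f j)) -> 0 < C -> 0 < e ->
  exists n : nat,
    let B := [set t | K t /\ exists j, 0 < `|f j t| <= C / n.+1%:R] in
    measurable (B : set (borelRd R d)) /\ (mu B <= e%:E)%E.
Proof.
move=> lf cK cf C0 e0.
pose B (n : nat) := [set t | K t /\ exists j, 0 < `|f j t| <= C / n.+1%:R].
have cf' j : continuous (fun t => `|f j t|).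
  by move=> t; apply: (@continuous_comp _ _ _ (f j) Num.norm); [exact: cf|exact: norm_continuous].
have clK : closed K by apply: compact_closed => //; exact: norm_hausdorff.
have mB n : measurable (B n : set (borelRd R d)).
  have -> : B n = K `&` \bigcup_(j in [set: 'I_N])
      ((fun t => `|f j t|) @^-1` [set y | 0 < y] `&`
       (fun t => `|f j t|) @^-1` [set y | y <= C / n.+1%:R]).
    apply/seteqP; split=> t.
      by move=> [Kt [j /andP[? ?]]]; split=> //; exists j.
    by move=> [Kt [j _ [/= a b]]]; split=> //; exists j; rewrite a.
  apply: measurableI; first exact: closed_borel.
  apply: fin_bigcup_measurable => // j _; apply: measurableI.
    by apply: open_borel; apply: open_comp; [move=> t _; exact: cf'|exact: open_gt].
  by apply: closed_borel; apply: closed_comp; [move=> t _; exact: cf'|exact: closed_le].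
(* Excluding the value 0 in [B] empties the intersection: at a fixed [t] the nonzero [|f j t|] have
   a positive lower bound [m]. *)
have B0 : \bigcap_n B n = set0.
  apply/seteqP; split=> // t Bt.
  pose m := \big[Num.min/1]_(j | f j t != 0) `|f j t|.
  have m0 : 0 < m by apply: lt_bigmin => // j; rewrite normr_gt0.
  pose n := Num.truncn (C / m).
  have [_ [j /andP[fj le]]] := Bt n I.
  have : m <= `|f j t| by apply: bigmin_le_cond; rewrite -normr_gt0.
  have : C / n.+1%:R < m.
    by rewrite ltr_pdivrMr// mulrC -ltr_pdivrMr//; apply: truncnS_gt.
  by move=> mC mf; have := lt_le_trans mC (le_trans mf le); rewrite ltxx.
have := @nonincreasing_cvg_mu _ _ _ mu B.
rewrite B0 measure0 => /(_ _ mB measurable0) cB.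
have {}cB : (mu \o B) n @[n --> \oo] --> 0%E.
  apply: cB.
    apply: le_lt_trans (lf K cK); apply: le_measure; rewrite ?inE//.
      exact: closed_borel.
    by move=> t [].
  move=> m n mn; apply/subsetPset => t [Kt [j /andP[a b]]]; split=> //; exists j.
  rewrite a /=; apply: le_trans b _; rewrite ler_pM2l// lef_pV2 ?posrE//.
  by rewrite ler_nat ltnS.
have [n _ hn] : \forall n \near \oo, (mu (B n) < e%:E)%E.
  have : nbhs (0%E : \bar R) [set y | (y < e%:E)%E].
    by apply: open_nbhs_nbhs; split; [exact: open_ereal_lt_ereal|rewrite /= lte_fin].
  by move/cB.
by exists n; split; [exact: mB|apply/ltW/hn => /=].
Qed.

End Translates.

(** * Blow-up at a subfacet *)

Section Blowup.
Context {R : realType} {d N : nat} {v : 'I_N -> 'rV[R]_d} {h : 'I_N -> R}.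
Let A := hrep v h.

Lemma closed_hrep : closed A.
Proof.
have -> : A = \bigcap_(j in [set: 'I_N]) (dotv (v j) @^-1` [set y | y <= h j]).
  by apply/seteqP; split=> [x Ax j _|x Ax j]; exact: Ax.
apply: closed_bigI => j _; apply: closed_comp; last exact: closed_le.
by move=> x _; apply: dotv_continuous.
Qed.

Lemma open_dotv (w : 'rV[R]_d) (D : set R) : open D -> open (dotv w @^-1` D).
Proof. by move=> oD; apply: open_comp => // x _; apply: dotv_continuous. Qed.

Lemma open_norm_lt (V : normedModType R) (C : R) : open [set x : V | `|x| < C].
Proof.
apply: (@open_comp _ _ (fun x : V => `|x|) [set y | y < C]); last exact: open_lt.
by move=> x _; apply: norm_continuous.
Qed.

Lemma near_dotv_gt0 (w x : 'rV[R]_d) : 0 < dotv w x -> \forall e \near x, 0 < dotv w e.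
Proof.
move=> wx; apply: (@open_nbhs_nbhs _ _ (dotv w @^-1` [set y | 0 < y])).
by split=> //; apply: open_dotv; apply: open_gt.
Qed.

Lemma near_dotv_lt (w x : 'rV[R]_d) (C : R) :
  `|dotv w x| < C -> \forall e \near x, `|dotv w e| < C.
Proof.
move=> wx; apply: (@open_nbhs_nbhs _ _ (dotv w @^-1` [set y | `|y| < C])).
by split=> //; apply: open_dotv; apply: (@open_norm_lt R).
Qed.

Lemma near_forall (P : 'I_N -> set 'rV[R]_d) (x : 'rV[R]_d) :
  (forall j, \forall e \near x, P j e) -> \forall e \near x, forall j, P j e.
Proof. by move=> Pj; apply: (@filter_forall _ _ P (nbhs x)). Qed.

Lemma near_always (P : set 'rV[R]_d) (x : 'rV[R]_d) :
  (forall e, P e) -> \forall e \near x, P e.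
Proof. by move=> Pe; apply: (@filterE _ (nbhs x)). Qed.

Lemma small_perturbation (I : finType) (p q : I -> R) :
  exists2 eta : R, 0 < eta & forall i, p i != 0 -> 0 < (p i + eta * q i) * p i.
Proof.
pose M i := p i ^+ 2 / (`|q i * p i| + 1).
have den i : 0 < `|q i * p i| + 1 by rewrite ltr_wpDl.
exists (\big[Num.min/1]_(i | p i != 0) M i / 2).
  rewrite divr_gt0//; apply: lt_bigmin => // i pi0.
  by rewrite divr_gt0// exprn_even_gt0.
move=> i pi0; set m := \big[_/_]_(i | _) _.
have m0 : 0 < m.
  apply: lt_bigmin => // k pk0.
  by rewrite divr_gt0// exprn_even_gt0.
have : m <= M i by apply: bigmin_le_cond.
rewrite ler_pdivlMr// => mM.
have := ler_norm (- (q i * p i)); rewrite normrN => le.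
have : m / 2 * (- (q i * p i)) <= m / 2 * `|q i * p i| by rewrite ler_pM2l ?divr_gt0.
by rewrite mulrDl expr2 in mM *; nra.
Qed.

Variables (mu : {measure set (borelRd R d) -> \bar R}) (t0 : 'rV[R]_d) (rA : R).
Hypothesis bA : forall x, A x -> `|x| <= rA.
Hypothesis symA : forall x, A x -> A (- t0 - x).
Hypothesis lf : locally_finite mu.
Hypothesis tA : conv_tiles A mu.

(** The centres of [A] and [A + t] are [- t0 / 2] and [t - t0 / 2], with midpoint [(t - t0) / 2].
    Membership in [U] says that this midpoint satisfies all constraints strictly, so that [A] and
    [A + t] overlap around it. *)
Let U : set 'rV[R]_d := [set t | forall j, dotv (v j) (t - t0) < h j *+ 2].

Let openU : open U.
Proof.
rewrite openE => t Ut; apply: near_forall => j.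
have := @open_nbhs_nbhs _ t (dotv (v j) @^-1` [set y | y < h j *+ 2 + dotv (v j) t0]).
move=> nb; near=> y.
have : dotv (v j) y < h j *+ 2 + dotv (v j) t0.
  near: y; apply: nb; split; first by apply: open_dotv; apply: open_lt.
  by have := Ut j; rewrite dotvBr /=; lra.
by rewrite dotvBr; lra.
Unshelve. all: by end_near. Qed.

Let muU0 : mu U = 0%E.
Proof.
apply: (mu_interior_diff0 closed_hrep tA openU) => t Ut.
pose m := 2^-1 *: (t - t0).
have m2 : t - t0 = m *+ 2 by rewrite -scaler_nat scalerA divff ?scale1r ?pnatr_eq0.
have mA : \forall y \near m, forall j, dotv (v j) y < h j.
  apply: near_forall => j.
  apply: (@open_nbhs_nbhs _ m (dotv (v j) @^-1` [set y | y < h j])).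
  split; first by apply: open_dotv; apply: open_lt.
  by have := Ut j; rewrite m2 dotvMnr ltr_pMn2r.
move: mA => /nbhs_ballP[r /= r0 rA']; exists m, r; split=> // y ym.
have yb : ball m r y by rewrite mx_norm_ball /ball_ /= distrC.
have y'b : ball m r (m *+ 2 - y).
  rewrite mx_norm_ball /ball_ /=; suff -> : m - (m *+ 2 - y) = y - m by [].
  by apply/rowP => i; rewrite mulr2n !mxE; ring.
split=> [j|]; first exact/ltW/(rA' _ yb).
have -> : y - t = - t0 - (m *+ 2 - y).
  by rewrite -m2; apply/rowP => i; rewrite !mxE; ring.
by apply: symA => j; apply/ltW/(rA' _ y'b).
Qed.

(** The premise introduced as [act] expresses that [x0] is a generic point of the subfacet; [hc]
    says that [c] is positive on every constraint constant along [l] and active somewhere on the two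
    faces. *)
Lemma blowup_contradiction (u1 u2 x0 l a c : 'rV[R]_d) (h1 h2 : R) :
  (forall x, A x -> dotv u1 x <= h1) -> (forall x, A x -> dotv u2 x <= h2) ->
  A x0 -> dotv u1 x0 = h1 -> dotv u2 x0 = h2 ->
  (forall j, v j != 0) ->
  (forall j, dotv (v j) x0 = h j -> exists al be : R,
     [/\ 0 <= al, 0 <= be & v j = al *: u1 + be *: u2]) ->
  dotv u1 l = 0 -> dotv u2 l = 0 ->
  (forall j z, dotv (v j) l = 0 -> A z -> dotv u1 z = h1 \/ dotv u2 z = h2 ->
     dotv (v j) z = h j -> 0 < dotv (v j) c) ->
  0 < dotv u1 a -> dotv u2 a < 0 -> False.
Proof.
move=> A1 A2 Ax0 x01 x02 v0 act l1 l2 hc a1 a2.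
have mcov x : measurable (covers A x : set (borelRd R d)).
  by apply: closed_borel; apply: closed_covers; exact: closed_hrep.
(* Adding [eta] times [a], [- a] or [c] to [l] keeps the sign of every constraint that is not
   constant along [l]; the index in ['I_3] selects the perturbation. *)
have [eta eta0 hb] := small_perturbation
  (fun j : 'I_N * 'I_3 => dotv (v j.1) l)
  (fun j => dotv (v j.1) (if j.2 == 0 then a else if j.2 == 1 then - a else c)).
pose ea := l + eta *: a; pose eb := l - eta *: a; pose ec := l + eta *: c.
have sgn j : dotv (v j) l != 0 -> [/\ 0 < dotv (v j) ea * dotv (v j) l,
    0 < dotv (v j) eb * dotv (v j) l & 0 < dotv (v j) ec * dotv (v j) l].
  move=> vl; have := hb (j, 0) vl; have := hb (j, 1) vl; have := hb (j, 2) vl.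
  by rewrite /= /ea /eb /ec -!scalerN !dotvDr !dotvZr.
pose C := `|ea| + `|eb| + `|ec| + 1 +
  \sum_j (`|dotv (v j) ea| + `|dotv (v j) eb| + `|dotv (v j) ec|).
have Cge0 : 0 <= \sum_j (`|dotv (v j) ea| + `|dotv (v j) eb| + `|dotv (v j) ec|).
  by apply: sumr_ge0 => j _; rewrite !addr_ge0.
have C0 : 0 < C by rewrite /C; have := (normr_ge0 ea, normr_ge0 eb, normr_ge0 ec) => -[[? ?] ?]; lra.
have Cj j : `|dotv (v j) ea| + `|dotv (v j) eb| + `|dotv (v j) ec| < C.
  rewrite /C (bigD1 j)//=.
  have : 0 <= \sum_(i | i != j) (`|dotv (v i) ea| + `|dotv (v i) eb| + `|dotv (v i) ec|).
    by apply: sumr_ge0 => i _; rewrite !addr_ge0.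
  by have := (normr_ge0 ea, normr_ge0 eb, normr_ge0 ec) => -[[? ?] ?]; lra.
(* Exact points are only known to be dense, so all conditions on the three directions are kept open,
   to be inherited by nearby directions. *)
pose near_ok (e : 'rV[R]_d) := [/\ `|e| < C, forall j, `|dotv (v j) e| < C &
  forall j, dotv (v j) l != 0 -> 0 < dotv (v j) e * dotv (v j) l].
have nbd (e0 : 'rV[R]_d) : `|e0| < C -> (forall j, `|dotv (v j) e0| < C) ->
    (forall j, dotv (v j) l != 0 -> 0 < dotv (v j) e0 * dotv (v j) l) ->
    \forall e \near e0, near_ok e.
  move=> e0C e0j e0l.
  have n1 : \forall e \near e0, `|e| < C.
    apply: (@open_nbhs_nbhs _ e0 [set e : 'rV[R]_d | `|e| < C]); split=> //.
    exact: open_norm_lt.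
  have n2 : \forall e \near e0, forall j, `|dotv (v j) e| < C.
    by apply: near_forall => j; apply: near_dotv_lt.
  have n3 : \forall e \near e0, forall j, dotv (v j) l != 0 -> 0 < dotv (v j) e * dotv (v j) l.
    apply: near_forall => j.
    have [->|vl] := eqVneq (dotv (v j) l) 0; first by apply: near_always.
    have : 0 < dotv (dotv (v j) l *: v j) e0 by rewrite dotvZl mulrC e0l.
    by move=> /near_dotv_gt0; apply: filterS => e; rewrite dotvZl mulrC.
  by apply: filterS3 n1 n2 n3 => e; split.
have nrm := (normr_ge0 ea, normr_ge0 eb, normr_ge0 ec).
have Ea : \forall e \near ea, [/\ near_ok e, 0 < dotv u1 e & 0 < dotv (- u2) e].
  have [] : 0 < dotv u1 ea /\ 0 < dotv (- u2) ea.
    rewrite dotvNl !dotvDr !dotvZr l1 l2 !add0r; split; first exact: mulr_gt0.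
    by rewrite oppr_gt0 pmulr_rlt0.
  move=> /near_dotv_gt0 n1 /near_dotv_gt0 n2.
  apply: filterS3 n1 n2 (nbd ea _ _ _) => [e *|||j /sgn[]//]; first by split.
    by rewrite /C; move: nrm => [[? ?] ?]; lra.
  by move=> j; have := Cj j; have := (normr_ge0 (dotv (v j) eb), normr_ge0 (dotv (v j) ec)) => -[? ?]; lra.
have Eb : \forall e \near eb, [/\ near_ok e, 0 < dotv (- u1) e & 0 < dotv u2 e].
  have [] : 0 < dotv (- u1) eb /\ 0 < dotv u2 eb.
    rewrite dotvNl !dotvBr !dotvZr l1 l2 !sub0r opprK; split; first exact: mulr_gt0.
    by rewrite oppr_gt0 pmulr_rlt0.
  move=> /near_dotv_gt0 n1 /near_dotv_gt0 n2.
  apply: filterS3 n1 n2 (nbd eb _ _ _) => [e *|||j /sgn[]//]; first by split.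
    by rewrite /C; move: nrm => [[? ?] ?]; lra.
  by move=> j; have := Cj j; have := (normr_ge0 (dotv (v j) ea), normr_ge0 (dotv (v j) ec)) => -[? ?]; lra.
have Ec : \forall e \near ec, near_ok e /\
    forall j, dotv (v j) l = 0 -> 0 < dotv (v j) c -> 0 < dotv (v j) e.
  have n1 : \forall e \near ec, forall j,
      dotv (v j) l = 0 -> 0 < dotv (v j) c -> 0 < dotv (v j) e.
    apply: near_forall => j.
    have [vl|vl] := eqVneq (dotv (v j) l) 0; last by apply: near_always => e /= /eqP; rewrite (negbTE vl).
    have [vc|vc] := ltP 0 (dotv (v j) c); last by apply: near_always.
    have : 0 < dotv (v j) ec by rewrite dotvDr dotvZr vl add0r mulr_gt0.
    by move=> /near_dotv_gt0; apply: filterS.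
  apply: filterS2 n1 (nbd ec _ _ _) => [e *|||j /sgn[]//]; first by split.
    by rewrite /C; move: nrm => [[? ?] ?]; lra.
  by move=> j; have := Cj j; have := (normr_ge0 (dotv (v j) ea), normr_ge0 (dotv (v j) eb)) => -[? ?]; lra.
clearbody C ea eb ec.
pose K : set 'rV[R]_d := [set t | `|t| <= `|x0| + C + rA].
have cK : compact K.
  apply: bounded_closed_compact.
    exists (`|x0| + C + rA); split; first exact: num_real.
    by move=> M /ltW xM t Kt; apply: le_trans xM.
  apply: (@closed_comp _ _ (fun t : 'rV[R]_d => `|t|) [set y | y <= `|x0| + C + rA]); last exact: closed_le.
  by move=> t _; apply: norm_continuous.
(* The slack of constraint [j] at [z = t - t0 - x0], the reflection of [x0 - t] in the centre of
   [A]. *)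
pose f j t := h j - dotv (v j) (t - t0 - x0).
have cf j : continuous (f j).
  have -> : f j = (fun t => (h j + dotv (v j) t0 + dotv (v j) x0) - dotv (v j) t).
    by apply/funext => t; rewrite /f !dotvBr; ring.
  move=> t; apply: (@continuousB _ _ _ (cst (h j + dotv (v j) t0 + dotv (v j) x0)) (dotv (v j)) t).
    exact: cst_continuous.
  exact: dotv_continuous.
(* Any bound below [1/2] on [mu B] would do: in the end twice [1 - 1/4] has to exceed 1. The scale
   [s] is [n.+1%:R^-1], so [B] collects the [t] in [K] with a nonzero slack of size at most
   [s * C]. *)
have [n [mB muB]] := mu_near_hyperplanes (e := 4^-1) lf cK cf C0 ltac:(by rewrite invr_gt0).
set B := [set t | _] in mB muB.
pose s : R := n.+1%:R^-1.
have s0 : 0 < s by rewrite invr_gt0.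
have s1 : s <= 1 by rewrite invf_le1// ler1n.
have pick (e0 : 'rV[R]_d) (P : 'rV[R]_d -> Prop) : (\forall e \near e0, P e) ->
    exists2 e, P e & exact_at mu A (x0 + s *: e).
  move=> eP; have /nbhs_ballP[r /= r0 rP] : nbhs e0 P := eP.
  have [y yr yA] := exact_at_dense (x0 + s *: e0) closed_hrep tA (mulr_gt0 s0 r0).
  exists (s^-1 *: (y - x0)); last by rewrite scalerA divff ?gt_eqF// scale1r addrC subrK.
  apply: rP; rewrite mx_norm_ball /ball_ /= distrC.
  have -> : s^-1 *: (y - x0) - e0 = s^-1 *: (y - (x0 + s *: e0)).
    by rewrite opprD addrA [RHS]scalerBr scalerA mulVf ?gt_eqF// scale1r.
  by rewrite normrZ gtr0_norm ?invr_gt0// mulrC ltr_pdivrMr// mulrC.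
have [e [[eC ej el] e1 e2] xe] := pick _ _ Ea.
have [e' [[e'C e'j e'l] e'1 e'2] xe'] := pick _ _ Eb.
have [e'' [[e''C e''j e''l] e''2] xe''] := pick _ _ Ec.
move: e2 e'1; rewrite !dotvNl !oppr_gt0 => e2 e'1.
have covK t (w : 'rV[R]_d) : `|w| < C -> covers A (x0 + s *: w) t -> K t.
  move=> wC /bA; rewrite /K /=.
  have := ler_normB (x0 + s *: w) (x0 + s *: w - t).
  rewrite opprB addrC subrK.
  have := ler_normD x0 (s *: w); rewrite normrZ gtr0_norm//.
  have : s * `|w| <= `|w| by rewrite ler_piMl.
  by lra.
have reflect_cov t w : covers A (x0 + s *: w) t <-> A (t - t0 - x0 - s *: w).
  have e3 : - t0 - (x0 + s *: w - t) = t - t0 - x0 - s *: w.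
    by apply/rowP => i; rewrite !mxE; ring.
  split=> /symA; first by rewrite e3.
  suff -> : - t0 - (t - t0 - x0 - s *: w) = x0 + s *: w - t by [].
  by apply/rowP => i; rewrite !mxE; ring.
(* Outside [B] a constraint is either exactly active at [z] or has slack beyond the reach [s * C] of
   the displacement. *)
have bdry t w : `|w| < C -> (forall j, `|dotv (v j) w| < C) ->
    covers A (x0 + s *: w) t -> ~ B t ->
    A (t - t0 - x0) /\ forall j, f j t = 0 \/ s * C < f j t.
  move=> wC wj ct nB.
  have fj j : f j t = 0 \/ s * C < f j t.
    have : - (s * C) <= f j t.
      have /reflect_cov/(_ j) := ct; rewrite [dotv _ (_ - s *: w)]dotvBr dotvZr /f.
      have := wj j; rewrite ltr_norml => /andP[wj1 wj2].
      have : s * dotv (v j) w <= s * C by rewrite ler_pM2l// ltW.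
      by lra.
    move=> fge; have [->|f0] := eqVneq (f j t) 0; [by left|right].
    have /negP : ~ (0 < `|f j t| <= C / n.+1%:R).
      by move=> fB; apply: nB; split; [exact: covK wC ct|exists j].
    rewrite normr_gt0 f0 /= -ltNge mulrC => big.
    have [f1|f1] := leP 0 (f j t); first by rewrite ger0_norm in big.
    by rewrite ltr0_norm// in big; move: big; rewrite -/s; lra.
  split=> // j; have [] := fj j; rewrite /f; first lra.
  by have := mulr_gt0 s0 C0; lra.
(* If [t] is not in [U], some constraint is active at both [z] and [x0]. Being a nonnegative
   combination of [u1] and [u2], it forces [z] onto one of the two faces. *)
have facet_or t : ~ U t -> A (t - t0 - x0) ->
    dotv u1 (t - t0 - x0) = h1 \/ dotv u2 (t - t0 - x0) = h2.
  move=> nU Az; have /existsNP[j /negP] := nU; rewrite -leNgt => le.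
  have := Az j; have := Ax0 j => xj zj.
  have e3 : dotv (v j) (t - t0) = dotv (v j) (t - t0 - x0) + dotv (v j) x0.
    by rewrite -dotvDr subrK.
  have xj' : dotv (v j) x0 = h j by lra.
  have zj' : dotv (v j) (t - t0 - x0) = h j by lra.
  have [al [be [al0 be0 vE]]] := act j xj'.
  move: zj'; rewrite -xj' vE !dotvDl !dotvZl x01 x02 => zj'.
  have z1 := A1 _ Az; have z2 := A2 _ Az.
  have [al1|al1] := eqVneq al 0.
    have be1 : 0 < be.
      rewrite lt_def be0 andbT; apply: contraTneq (v0 j) => be1.
      by rewrite vE al1 be1 !scale0r addr0 eqxx.
    by right; apply: (mulfI (lt0r_neq0 be1)); move: zj'; rewrite al1; lra.
  left; have {}al1 : 0 < al by rewrite lt_def al1.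
  apply: (mulfI (lt0r_neq0 al1)).
  have : al * dotv u1 (t - t0 - x0) <= al * h1 by rewrite ler_pM2l.
  have : be * dotv u2 (t - t0 - x0) <= be * h2 by rewrite ler_wpM2l.
  by lra.
(* Only constraints active at [z] matter. Those constant along [l] are positive on [e''] by [hc];
   the others are nonnegative on [w] because [t] covers [x0 + s *: w], and [w], [l], [e''] give them
   the same sign. *)
have into t (w : 'rV[R]_d) : `|w| < C -> (forall j, `|dotv (v j) w| < C) ->
    (forall j, dotv (v j) l != 0 -> 0 < dotv (v j) w * dotv (v j) l) ->
    covers A (x0 + s *: w) t -> ~ B t -> ~ U t -> covers A (x0 + s *: e'') t.
  move=> wC wj wl ct nB nU; apply/reflect_cov => j.
  have [Az fz] := bdry t w wC wj ct nB; rewrite dotvBr dotvZr.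
  have := e''j j; rewrite ltr_norml => /andP[ej1 ej2].
  have : - (s * C) < s * dotv (v j) e'' by rewrite -mulrN ltr_pM2l.
  have [f0|] := fz j; last by rewrite /f; lra.
  move=> _; suff e0 : 0 < dotv (v j) e''.
    by have := mulr_gt0 s0 e0; rewrite /f in f0; lra.
  have zj : dotv (v j) (t - t0 - x0) = h j by rewrite /f in f0; lra.
  have [vl|vl] := eqVneq (dotv (v j) l) 0.
    by apply: e''2 => //; apply: (hc j (t - t0 - x0)) => //; exact: facet_or.
  have /reflect_cov/(_ j) := ct; rewrite [dotv _ (_ - s *: w)]dotvBr dotvZr zj => sw.
  have w0 : 0 <= dotv (v j) w by rewrite -(pmulr_rge0 _ s0); lra.
  have := wl j vl; have := e''l j vl => p1 p2.
  have l0 : 0 < dotv (v j) l by nra.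
  by rewrite -(pmulr_lgt0 _ l0).
have notA w : (0 < dotv u1 w \/ 0 < dotv u2 w) -> ~ A (x0 + s *: w).
  by move=> [] w0 Aw; [have := A1 _ Aw|have := A2 _ Aw];
    rewrite dotvDr dotvZr ?x01 ?x02; have := mulr_gt0 s0 w0; lra.
have mu1 := exact_at_out xe (notA _ (or_introl e1)).
have mu2 := exact_at_out xe' (notA _ (or_intror e'2)).
have mu3 := exact_at_le1 xe''.
pose BU := B `|` U.
have mBU : measurable (BU : set (borelRd R d)).
  by apply: measurableU => //; exact: open_borel.
have muBU : (mu BU <= (4^-1)%:E)%E.
  have mU : measurable (U : set (borelRd R d)) by apply: open_borel.
  by have := @measureU2 _ _ _ mu _ _ mB mU; rewrite [X in (_ + X)%E]muU0 adde0 => /le_trans; apply.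
pose Sa : set (borelRd R d) := covers A (x0 + s *: e) `\` BU.
pose Sb : set (borelRd R d) := covers A (x0 + s *: e') `\` BU.
have mSa : measurable Sa by apply: measurableD.
have mSb : measurable Sb by apply: measurableD.
have large (S : set (borelRd R d)) : measurable S -> mu S = 1%E ->
    ((1 - 4^-1)%:E <= mu (S `\` BU))%E.
  move=> mS S1.
  have : (mu S <= mu (S `\` BU) + mu BU)%E.
    apply: le_trans (measureU2 _ _ _); rewrite ?inE//; last exact: measurableD.
    apply: le_measure; rewrite ?inE//; first by apply: measurableU => //; apply: measurableD.
    by move=> t St; have [?|?] := pselect (BU t); [right|left].
  rewrite S1 EFinB leeBlDr// => /le_trans; apply.
  exact: leeD2l.
have ba := large _ (mcov _) mu1; have bb := large _ (mcov _) mu2.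
have : (mu (Sa `|` Sb) <= 1)%E.
  apply: le_trans mu3; apply: le_measure; rewrite ?inE//; first exact: measurableU.
  move=> t [] [ct nBU]; apply: into ct _ _ => // ?; apply: nBU; [left|right|left|right] => //.
(* Disjointness: [u2] is negative on [e] and [u1] on [e'], so covering both points keeps [z] off
   both faces, against [facet_or]. *)
rewrite measureU//; last first.
  apply/seteqP; split=> // t [[ct nBU] [ct' _]].
  have nB : ~ B t by move=> ?; apply: nBU; left.
  have nU : ~ U t by move=> ?; apply: nBU; right.
  have [Az _] := bdry _ _ eC ej ct nB.
  have := facet_or t nU Az.
  have /reflect_cov/A2 := ct; have /reflect_cov/A1 := ct'.
  rewrite ![dotv _ (_ - s *: _)]dotvBr !dotvZr.
  have : s * dotv u2 e < 0 by rewrite pmulr_rlt0.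
  have : s * dotv u1 e' < 0 by rewrite pmulr_rlt0.
  by move=> p1 p2 p3 p4 []; lra.
move=> le1; have := le_trans (leeD ba bb) le1.
by rewrite -EFinD lee_fin; lra.
Qed.

End Blowup.

(** * Facets and belts *)

Section Facets.
Context {R : realType} {d : nat} {A : set 'rV[R]_d}.

Lemma face_supporting F : is_face A F ->
  exists (u : 'rV[R]_d) (h : R), [/\ u != 0, forall x, A x -> dotv u x <= h &
    forall x, F x <-> A x /\ dotv u x = h].
Proof.
move=> [[x0 Fx0] [u [u0 FE]]]; exists u, (dotv u x0).
move: (Fx0); rewrite FE => -[Ax0 max0]; split=> // x; split.
  move=> [Ax maxx]; split=> //; apply/le_anti.
  by rewrite max0// maxx.
by move=> [Ax xE]; split=> // y Ay; rewrite xE max0.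
Qed.

Lemma row_mulmx0 k (a : 'I_k -> 'rV[R]_d) w :
  (forall i, dotv w (a i) = 0) -> (\matrix_(i < k) a i) *m w^T = 0.
Proof.
move=> wa; apply/row_matrixP => i.
by rewrite row_mul rowK row0 dotvE dotvC wa raddf0.
Qed.

Lemma facet_parallel F u w : facet A F -> u != 0 ->
  (forall x y, F x -> F y -> dotv u x = dotv u y) ->
  (forall x y, F x -> F y -> dotv w x = dotv w y) -> exists k, w = k *: u.
Proof.
move=> [_ [[p [Fp fp]] _]] u0 cu cw.
apply: (parallel_of_corank1 fp u0); apply: row_mulmx0 => i; rewrite dotvBr.
- by rewrite (cu _ (p ord0))// subrr.
- by rewrite (cw _ (p ord0))// subrr.
Qed.

Lemma not_constant (u : 'rV[R]_d) (k : R) : A° !=set0 -> u != 0 ->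
  (forall x, A x -> dotv u x = k) -> False.
Proof.
move=> [p pA] u0 cst_u.
have : \forall s \near (0 : R), A (p + s *: u).
  have : (fun s : R => p + s *: u) s @[s --> (0 : R)] --> p.
    rewrite -{2}[p]addr0 -(scale0r u).
    apply: cvgD; [exact: cvg_cst|apply: cvgZr_tmp; exact: cvg_id].
  by apply.
move=> /nbhs_ballP[r /= r0 rA].
have /cst_u : A (p + (r / 2) *: u).
  apply: rA; rewrite /ball /= sub0r normrN gtr0_norm ?divr_gt0//.
  by rewrite ltr_pdivrMr// mulr_natr mulr2n ltrDl.
rewrite dotvDr dotvZr cst_u; last exact: nbhs_singleton.
by have := mulr_gt0 (divr_gt0 r0 (ltr0n R 2)) (dotv_gt0 u0); lra.
Qed.

End Facets.

(** * Supporting forms along a belt *)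

Section Belt.
Context {R : realType} {d : nat} {A : set 'rV[R]_d}.
Hypothesis intA : A° !=set0.
Variables (F : nat -> set 'rV[R]_d) (u : nat -> 'rV[R]_d) (h : nat -> R).
Hypothesis facetF : forall i, facet A (F i).
Hypothesis u_neq0 : forall i, u i != 0.
Hypothesis u_le : forall i x, A x -> dotv (u i) x <= h i.
Hypothesis FE : forall i x, F i x <-> A x /\ dotv (u i) x = h i.
Hypothesis F_neq : forall i, F i <> F i.+1.
Hypothesis F_step : forall i, exists c, is_center c (F i.+1) /\
  F i.+1 `&` F i.+2 = reflect_set c (F i `&` F i.+1).
Variable p : 'I_(d.-2).+1 -> 'rV[R]_d.
Hypothesis p_in : forall k, (F 0 `&` F 1) (p k).
Hypothesis p_free : aff_indep p.

Let G i : set 'rV[R]_d := F i `&` F i.+1.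

Let FA i x : F i x -> A x. Proof. by move=> /FE[]. Qed.
Let Fh i x : F i x -> dotv (u i) x = h i. Proof. by move=> /FE[]. Qed.

(** Each reflection negates differences of points, so [s] is a sign, of which only [s != 0] is
    recorded. All subfacets of the belt thus share the directions of the first. *)
Lemma subfacet_points i : exists (q : 'I_(d.-2).+1 -> 'rV[R]_d) (s : R),
  [/\ s != 0, forall k, G i (q k) & forall k, q k - q ord0 = s *: (p k - p ord0)].
Proof.
elim: i => [|i [q [s [s0 qG qE]]]].
  by exists p, 1; split=> [||k]; rewrite ?oner_neq0 ?scale1r.
have [c [_ cE]] := F_step i.
exists (fun k => c *+ 2 - q k), (- s); split=> [|k|k]; first by rewrite oppr_eq0.
  by rewrite /G cE; exists (q k) => //; apply: qG.
by rewrite scaleNr -qE; apply/rowP => a; rewrite mulr2n !mxE; ring.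
Qed.

(* Annihilator of the common direction of the subfacets of the belt. *)
Let W : set 'rV[R]_d := [set w | forall k, dotv w (p k - p ord0) = 0].

Let W_const i w : (forall x y, G i x -> G i y -> dotv w x = dotv w y) -> W w.
Proof.
move=> wc k; have [q [s [s0 qG qE]]] := subfacet_points i.
apply: (mulfI s0); rewrite mulr0 -dotvZr -qE dotvBr.
by rewrite (wc _ _ (qG k) (qG ord0)) subrr.
Qed.

Let uW i : W (u i).
Proof. by apply: (@W_const i) => x y [/Fh -> _] [/Fh -> _]. Qed.

Let G_neq0 i : exists g, G i g.
Proof. by have [q [_ [_ qG _]]] := subfacet_points i; exists (q ord0). Qed.

(** A positive factor would make the two facets equal; a negative one would make [u i] constant on
    [A], since both maxima are attained at a common point. *)
Lemma consecutive_indep i : ~ exists k, u i.+1 = k *: u i.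
Proof.
move=> [k uE]; have [g [gi gi1]] := G_neq0 i.
have hE : h i.+1 = k * h i by rewrite -(Fh gi1) uE dotvZl (Fh gi).
case: (ltgtP k 0) => k0.
- apply: (not_constant (k := h i) intA (u_neq0 i)) => x Ax; apply/le_anti.
  rewrite u_le//=; have := u_le i.+1 Ax.
  by rewrite uE dotvZl hE ler_nM2l.
- apply: (@F_neq i); apply/seteqP; split=> x /FE[Ax xE]; apply/FE; split=> //.
    by rewrite uE dotvZl xE.
  by move: xE; rewrite uE dotvZl hE; apply: mulfI; rewrite gt_eqF.
- by have := u_neq0 i.+1; rewrite uE k0 scale0r eqxx.
Qed.

(** Otherwise both normals would be constant on [F i], hence parallel by [facet_parallel]. *)
Lemma facet_off_next i : exists2 x, F i x & dotv (u i.+1) x < h i.+1.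
Proof.
apply: contrapT => /forall2NP nx.
have Fe x : F i x -> dotv (u i.+1) x = h i.+1.
  move=> Fx; apply/eqP; rewrite eq_le (u_le _ (FA Fx)) /= leNgt; apply/negP.
  by case: (nx x).
apply: (@consecutive_indep i); apply: (facet_parallel (facetF i)) => //.
- by move=> x y /Fh -> /Fh ->.
- by move=> x y /Fe -> /Fe ->.
Qed.

Lemma facet_off_prev i : exists2 x, F i.+1 x & dotv (u i) x < h i.
Proof.
apply: contrapT => /forall2NP nx.
have Fe x : F i.+1 x -> dotv (u i) x = h i.
  move=> Fx; apply/eqP; rewrite eq_le (u_le _ (FA Fx)) /= leNgt; apply/negP.
  by case: (nx x).
apply: (@consecutive_indep i); apply: (facet_parallel (facetF i.+1)) => //.
- by move=> x y /Fe -> /Fe ->.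
- by move=> x y /Fh -> /Fh ->.
Qed.

Lemma span_consecutive i w : W w -> exists a b, w = a *: u i + b *: u i.+1.
Proof.
move=> Ww; apply: (span_of_corank2 p_free) => //; first exact: consecutive_indep.
- by apply: row_mulmx0 => k; apply: uW.
- by apply: row_mulmx0 => k; apply: uW.
- by apply: row_mulmx0 => k; apply: Ww.
Qed.

Lemma edge i : exists g c, [/\ G i g, G i.+1 (c *+ 2 - g) & is_center c (F i.+1)].
Proof.
have [g Gg] := G_neq0 i; have [c [cc cE]] := F_step i.
by exists g, c; split=> //; rewrite /G cE; exists g.
Qed.

(** The vector leads across [F i.+1] from a point [g] of [G i] to its reflection in [G i.+1]. *)
Lemma edge_direction i : exists e : 'rV[R]_d,
  [/\ dotv (u i) e < 0, dotv (u i.+1) e = 0 & 0 < dotv (u i.+2) e].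
Proof.
have [g [c [[gi gi1] [g'i1 g'i2] cc]]] := edge i.
have Fc x : F i.+1 x -> F i.+1 (c *+ 2 - x) by move/cc.
pose g' := c *+ 2 - g.
have g'E w : dotv w g' = dotv w (c *+ 2) - dotv w g by rewrite dotvBr.
exists (g' - g); rewrite !(dotvBr _ g' g); split.
(* If [u i] took the value [h i] at both [g] and its reflection, a point of [F i.+1] below [h i]
   would be reflected to one above it. *)
- rewrite subr_lt0 (Fh gi) lt_neqAle (u_le _ (FA g'i1)) andbT; apply/eqP => e.
  have [x Fx xlt] := facet_off_prev i.
  have := u_le i (FA (Fc _ Fx)); move: e.
  by rewrite g'E dotvBr (Fh gi); lra.
- by rewrite (Fh g'i1) (Fh gi1) subrr.
- rewrite subr_gt0 (Fh g'i2) lt_neqAle (u_le _ (FA gi1)) andbT; apply/eqP => e.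
  have [x Fx xlt] := facet_off_next i.+1.
  have := u_le i.+2 (FA (Fc _ Fx)); have := Fh g'i2.
  by rewrite g'E dotvBr e; lra.
Qed.

(** A form maximal at [g] cannot increase towards a point of [F i] off [F i.+1], where only [u i.+1]
    drops; so [b] is nonnegative, and symmetrically [a]. *)
Lemma active_coef_ge0 i w a b k g : w = a *: u i + b *: u i.+1 ->
  (forall x, A x -> dotv w x <= k) -> G i g -> dotv w g = k -> 0 <= a /\ 0 <= b.
Proof.
move=> -> wk [/Fh gi /Fh gi1]; rewrite dotvDl !dotvZl gi gi1 => ek.
have [x Fx lx] := facet_off_next i; have [y Fy ly] := facet_off_prev i.
have := wk _ (FA Fx); rewrite dotvDl !dotvZl (Fh Fx) -ek => xk.
have := wk _ (FA Fy); rewrite dotvDl !dotvZl (Fh Fy) -ek => yk.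
split; rewrite leNgt; apply/negP => n0.
  by have : 0 < a * (dotv (u i) y - h i); [rewrite nmulr_rgt0// subr_lt0|lra].
by have : 0 < b * (dotv (u i.+1) x - h i.+1); [rewrite nmulr_rgt0// subr_lt0|lra].
Qed.

Lemma active_pos i w k g c : W w -> w != 0 -> (forall x, A x -> dotv w x <= k) ->
  G i g -> dotv w g = k -> 0 < dotv (u i) c -> 0 < dotv (u i.+1) c -> 0 < dotv w c.
Proof.
move=> /(span_consecutive i)[a [b wE]] w0 wk Gg gk ci ci1.
have [a0 b0] := active_coef_ge0 wE wk Gg gk.
rewrite wE dotvDl !dotvZl.
have [a1|a1] := eqVneq a 0.
  rewrite a1 mul0r add0r mulr_gt0// lt_def b0 andbT; apply: contraNneq w0 => b1.
  by rewrite wE a1 b1 !scale0r addr0.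
by rewrite ltr_pwDl ?mulr_ge0 ?(ltW ci1)// mulr_gt0// lt_def a1.
Qed.

(* In the plane of the belt F i.+1 is the segment between G i and G i.+1. *)
Lemma active_at_end i w k z : W w -> (forall x, A x -> dotv w x <= k) ->
  F i.+1 z -> dotv w z = k ->
  (exists2 g, G i g & dotv w g = k) \/ (exists2 g, G i.+1 g & dotv w g = k).
Proof.
move=> /(span_consecutive i)[a [b wE]] wk Fz zk.
have [g [c [[gi gi1] [g'i1 g'i2] cc]]] := edge i.
have le x : A x -> k <= dotv w x -> dotv w x = k.
  by move=> Ax kx; apply/le_anti; rewrite wk.
have [a0|a0] := leP 0 a; [left; exists g => //|right; exists (c *+ 2 - g) => //].
  apply: le; first exact: FA gi.
  rewrite -zk wE !dotvDl !dotvZl (Fh gi) (Fh gi1) (Fh Fz) lerD2r.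
  by rewrite ler_wpM2l// (u_le _ (FA Fz)).
apply: le; first exact: FA g'i1.
rewrite -zk wE !dotvDl !dotvZl (Fh g'i1) (Fh Fz) lerD2r ler_nM2l//.
have /cc Fz' := Fz; have := u_le i (FA Fz'); rewrite !dotvBr (Fh gi); lra.
Qed.

Lemma coord_exists : exists al be : nat -> R,
  forall i, u i = al i *: u 0 + be i *: u 1.
Proof.
have /choice[f fE] : forall i, exists ab : R * R, u i = ab.1 *: u 0 + ab.2 *: u 1.
  by move=> i; have [a [b ->]] := span_consecutive 0 (uW i); exists (a, b).
by exists (fun i => (f i).1), (fun i => (f i).2).
Qed.

Lemma indep01 a b : a *: u 0 + b *: u 1 = 0 -> a = 0 /\ b = 0.
Proof.
move=> e; have [b0|b0] := eqVneq b 0.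
  split=> //; move/eqP: e; rewrite b0 scale0r addr0 scaler_eq0 (negbTE (u_neq0 0)) orbF.
  by move/eqP.
case: (@consecutive_indep 0); exists (- (b^-1 * a)).
apply: (scalerI b0); rewrite scalerA mulrN mulrA divff// mul1r scaleNr.
by apply/eqP; rewrite -addr_eq0 addrC e.
Qed.

(** * Turning of the normals in the plane of the belt *)

Variables al be : nat -> R.
Hypothesis uE : forall i, u i = al i *: u 0 + be i *: u 1.

(** The determinant of [u i] and [u j] in the basis [u 0], [u 1]: positive when [u j] is ahead of
    [u i] by less than a half turn. *)
Let om i j := al i * be j - be i * al j.

Let coord_inj a b a' b' :
  a *: u 0 + b *: u 1 = a' *: u 0 + b' *: u 1 -> a = a' /\ b = b'.
Proof.
move=> /eqP; rewrite -subr_eq0 opprD addrACA -!scalerBl => /eqP/indep01[/eqP + /eqP].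
by rewrite !subr_eq0 => /eqP -> /eqP ->.
Qed.

(** By induction, evaluating the linear relation between three consecutive normals on the vector of
    [edge_direction], where the middle one vanishes and the outer ones have opposite signs. *)
Lemma om_gt0 i : 0 < om i i.+1.
Proof.
elim: i => [|i IH].
  have [a0 b0] : al 0 = 1 /\ be 0 = 0.
    by apply: coord_inj; rewrite -uE scale1r scale0r addr0.
  have [a1 b1] : al 1 = 0 /\ be 1 = 1.
    by apply: coord_inj; rewrite -uE scale1r scale0r add0r.
  by rewrite /om a0 b0 a1 b1 mul1r mul0r subr0.
have [e []] := edge_direction i.
have dE k : dotv (u k) e = al k * dotv (u 0) e + be k * dotv (u 1) e.
  by rewrite {1}uE dotvDl !dotvZl.
have : om i.+1 i.+2 * dotv (u i) e + om i i.+1 * dotv (u i.+2) e =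
    om i i.+2 * dotv (u i.+1) e by rewrite (dE i) (dE i.+1) (dE i.+2) /om; ring.
move=> + ei ei1 ei2; rewrite ei1 mulr0 => E.
have : om i.+1 i.+2 * dotv (u i) e < 0.
  by have := mulr_gt0 IH ei2; lra.
by rewrite nmulr_llt0.
Qed.

Variable t0 : 'rV[R]_d.
Hypothesis symA : forall x, A x -> A (- t0 - x).

(** The hypotheses place [- u j] strictly inside the cone of [u i] and [u i.+1]. On the reflection
    of [F j] the form [- u j] is maximal, so this reflection lies in both [F i] and [F i.+1]; both
    normals are then constant on [F j], hence parallel. *)
Lemma no_antipode_between i j : 0 < om i.+1 j -> 0 < om j i -> False.
Proof.
move=> w0 z0; have D0 := om_gt0 i; have [g [gi gi1]] := G_neq0 i.
have dE x : om i i.+1 * - dotv (u j) x =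
    om i.+1 j * dotv (u i) x + om j i * dotv (u i.+1) x.
  have E k : dotv (u k) x = al k * dotv (u 0) x + be k * dotv (u 1) x.
    by rewrite {1}uE dotvDl !dotvZl.
  by rewrite (E j) (E i) (E i.+1) /om; ring.
have key x : F j x -> dotv (u i) (- t0 - x) = h i /\ dotv (u i.+1) (- t0 - x) = h i.+1.
  move=> Fx; have Ay := symA (FA Fx).
  have le1 := u_le i Ay; have le2 := u_le i.+1 Ay.
  have := u_le j (symA (FA gi)); rewrite dotvBr dotvNr => le3.
  have e1 := dE (- t0 - x); have e2 := dE g; rewrite (Fh gi) (Fh gi1) in e2.
  rewrite dotvBr dotvNr (Fh Fx) in e1.
  have m1 : 0 <= om i.+1 j * (h i - dotv (u i) (- t0 - x)).
    by apply: mulr_ge0; [exact: ltW|rewrite subr_ge0].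
  have m2 : 0 <= om j i * (h i.+1 - dotv (u i.+1) (- t0 - x)).
    by apply: mulr_ge0; [exact: ltW|rewrite subr_ge0].
  have m3 : om i i.+1 * - dotv (u j) g <= om i i.+1 * - (- dotv (u j) t0 - h j).
    by rewrite ler_pM2l//; lra.
  split; apply/eqP; rewrite eq_sym -subr_eq0.
    rewrite -(mulrI_eq0 _ (mulfI (lt0r_neq0 w0))) eq_le m1 andbT; lra.
  rewrite -(mulrI_eq0 _ (mulfI (lt0r_neq0 z0))) eq_le m2 andbT; lra.
apply: (@consecutive_indep i); apply: (facet_parallel (facetF j)) => // x y.
  by move=> /key[+ _] /key[+ _]; rewrite !dotvBr !dotvNr; lra.
by move=> /key[_ +] /key[_ +]; rewrite !dotvBr !dotvNr; lra.
Qed.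

Let om_anti i j : om i j = - om j i. Proof. by rewrite /om; ring. Qed.

Let multiple i j k := al j = k * al i /\ be j = k * be i.

Let om_multipler i j k l : multiple i j k -> om l j = k * om l i.
Proof. by move=> [e1 e2]; rewrite /om e1 e2; ring. Qed.

Let om_multiplel i j k l : multiple i j k -> om j l = k * om i l.
Proof. by move=> [e1 e2]; rewrite /om e1 e2; ring. Qed.

Let multiple_u i j k : multiple i j k <-> u j = k *: u i.
Proof.
split=> [[e1 e2]|]; rewrite (uE i) (uE j) scalerDr !scalerA.
  by rewrite e1 e2.
by move=> /coord_inj[].
Qed.

Lemma om_eq0 i j : om i j = 0 -> exists k, multiple i j k.
Proof.
move=> om0; have [a0|a0] := eqVneq (al i) 0.
  have b0 : be i != 0.
    by apply: contraNneq (u_neq0 i) => b0; rewrite uE a0 b0 !scale0r addr0.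
  exists (be j / be i); split; last by rewrite divfK.
  rewrite a0 mulr0; apply: (mulfI b0); move: om0; rewrite /om a0; lra.
exists (al j / al i); split; first by rewrite divfK.
apply: (mulfI a0); have -> : al i * (al j / al i * be i) = al j * be i by field.
by move: om0; rewrite /om; lra.
Qed.

(** The form [u j] is maximal where [u i] is minimal, which by the symmetry of [A] is the reflection
    of the face where [u i] is maximal. *)
Lemma antipodal_facet i j k : multiple i j k -> k < 0 ->
  forall x, F j x <-> F i (- t0 - x).
Proof.
move=> /multiple_u ujE k0.
have symK x : - t0 - (- t0 - x) = x by rewrite opprB addrC subrK.
have lo x : A x -> - dotv (u i) t0 - h i <= dotv (u i) x.
  by move=> /symA/(u_le i); rewrite dotvBr dotvNr; lra.
have [y0 [yi _]] := G_neq0 i; have [x0 [xj _]] := G_neq0 j.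
move=> x; split=> [Fx|/FE[Ay]].
  apply/FE; split; first exact: symA (FA Fx).
  have := u_le j (symA (FA yi)); rewrite -(Fh Fx) ujE !dotvZl ler_nM2l//.
  rewrite !dotvBr !dotvNr (Fh yi); have := lo _ (FA Fx); lra.
rewrite dotvBr dotvNr => xE; apply/FE; split; first by rewrite -[x]symK; apply: symA.
apply/le_anti/andP; split; first by apply: u_le; rewrite -[x]symK; apply: symA.
rewrite -(Fh xj) ujE !dotvZl ler_nM2l//.
by have := lo _ (FA xj); lra.
Qed.

Lemma eq_facet_multiple i j : F i = F j -> exists2 k, 0 < k & multiple i j k.
Proof.
move=> Fij.
have [k ujE] : exists k, u j = k *: u i.
  apply: (facet_parallel (facetF i)) => // x y; first by move=> /Fh -> /Fh ->.
  by rewrite Fij => /Fh -> /Fh ->.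
exists k; last exact/multiple_u.
have [g [gi _]] := G_neq0 i.
have hE : h j = k * h i.
  by move: (gi); rewrite Fij => /Fh <-; rewrite ujE dotvZl (Fh gi).
case: (ltgtP k 0) => // k0; exfalso.
- apply: (not_constant (k := h i) intA (u_neq0 i)) => x Ax; apply/le_anti.
  rewrite u_le//=; have := u_le j Ax.
  by rewrite ujE dotvZl hE ler_nM2l.
- by have := u_neq0 j; rewrite ujE k0 scale0r eqxx.
Qed.

Let om_refl i : om i i = 0. Proof. by rewrite /om; ring. Qed.

Let neq_of_om i j : om i j != 0 -> F i <> F j.
Proof.
move=> om0 /eq_facet_multiple[k _ /(@om_multipler i j k i)].
by rewrite om_refl mulr0 => e; rewrite e eqxx in om0.
Qed.

Let neq_of_neg i j k : multiple i j k -> k < 0 -> F i <> F j.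
Proof.
move=> /multiple_u uk k0 /eq_facet_multiple[k' k'0 /multiple_u uk'].
have /eqP : (k' - k) *: u i = 0 by rewrite scalerBl -uk -uk' subrr.
by rewrite scaler_eq0 (negbTE (u_neq0 i)) orbF; apply/negP; rewrite gt_eqF//; lra.
Qed.

(** Otherwise [- u i] would fall strictly between [u i.+1] and [u i.+2]. *)
Lemma om2_ge0 i : 0 <= om i i.+2.
Proof.
rewrite leNgt; apply/negP => o2.
apply: (@no_antipode_between i.+1 i); last exact: om_gt0.
by rewrite om_anti oppr_gt0.
Qed.

Lemma om3_ge0 i : 0 < om i i.+2 -> 0 <= om i i.+3.
Proof.
move=> o2; rewrite leNgt; apply/negP => o3.
by apply: (@no_antipode_between i.+2 i) => //; rewrite om_anti oppr_gt0.
Qed.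

Lemma multiple2 i : om i i.+2 = 0 -> exists2 k, k < 0 & multiple i i.+2 k.
Proof.
move=> /om_eq0[k ik]; exists k => //.
have := om_gt0 i.+1; rewrite (om_multipler _ ik) om_anti mulrN oppr_gt0.
by rewrite pmulr_llt0 ?om_gt0.
Qed.

Lemma multiple3 i : 0 < om i i.+2 -> om i i.+3 = 0 ->
  exists2 k, k < 0 & multiple i i.+3 k.
Proof.
move=> o2 /om_eq0[k ik]; exists k => //.
have := om_gt0 i.+2; rewrite (om_multipler _ ik) om_anti mulrN oppr_gt0.
by rewrite pmulr_llt0.
Qed.

(** If only the left side vanished, [- u i.+3] would lie strictly between [u i] and [u i.+1]; if
    only the right side did, [- u i] would lie strictly between [u i.+2] and [u i.+3]. Vanishing is
    thus a property of the whole belt. *)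
Lemma om2_eq0_succ i : (om i i.+2 == 0) = (om i.+1 i.+3 == 0).
Proof.
apply/eqP/eqP => [/multiple2[k k0 ik]|/multiple2[k k0 ik]].
  apply/eqP; apply: contraT => n0; exfalso.
  have o : 0 < om i.+1 i.+3 by rewrite lt_def n0 om2_ge0.
  apply: (@no_antipode_between i i.+3) => //.
  have := om_gt0 i.+2; rewrite (om_multiplel _ ik) om_anti.
  by rewrite nmulr_rgt0// oppr_lt0.
apply/eqP; apply: contraT => n0; exfalso.
have o : 0 < om i i.+2 by rewrite lt_def n0 om2_ge0.
apply: (@no_antipode_between i.+2 i) => //.
by rewrite (om_multiplel _ ik) om_anti nmulr_rgt0// oppr_lt0 om_gt0.
Qed.

(** The vector [e] points along [F i] towards [F i.+1]: it annihilates [u i] and is positive on each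
    [u j] with [0 < om i j]. Adding a small multiple of [u i] makes the value on [u i] positive
    too. *)
Lemma common_positive i : 0 < om i i.+2 -> 0 < om i i.+3 ->
  exists c, forall k, (k < 4)%N -> 0 < dotv (u (k + i)) c.
Proof.
move=> o2 o3; have o1 := om_gt0 i.
have [g [gi gi1]] := G_neq0 i; have [x Fx xlt] := facet_off_next i.
pose e := g - x.
have ei : dotv (u i) e = 0 by rewrite dotvBr (Fh gi) (Fh Fx) subrr.
have ei1 : 0 < dotv (u i.+1) e by rewrite dotvBr (Fh gi1); lra.
have pos j : 0 < om i j -> 0 < dotv (u j) e.
  move=> oj; rewrite -(pmulr_rgt0 _ o1).
  have E k : dotv (u k) e = al k * dotv (u 0) e + be k * dotv (u 1) e.
    by rewrite {1}uE dotvDl !dotvZl.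
  have -> : om i i.+1 * dotv (u j) e =
      om i j * dotv (u i.+1) e - om i.+1 j * dotv (u i) e.
    by rewrite (E j) (E i) (E i.+1) /om; ring.
  by rewrite ei mulr0 subr0 mulr_gt0.
have [eta eta0 hb] := small_perturbation
  (fun k : 'I_4 => dotv (u (k + i)) e) (fun k : 'I_4 => dotv (u (k + i)) (u i)).
exists (e + eta *: u i) => -[|k] k4; rewrite dotvDr dotvZr.
  by rewrite add0n ei add0r mulr_gt0// dotv_gt0.
have pk : 0 < dotv (u (k.+1 + i)) e.
  by apply: pos; case: k k4 => [|[|[|]]].
by have := hb (Ordinal k4); rewrite /= gt_eqF// => /(_ isT); rewrite pmulr_lgt0.
Qed.

(** The blow-up takes place at the middle subfacet [G i.+1] of the four facets. A constraint in [W]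
    active on [F i.+1] or [F i.+2] is active at an end of that facet, hence in the cone of two
    consecutive normals among the four, where [c] is positive. *)
Lemma no_common_positive N (v : 'I_N -> 'rV[R]_d) (b : 'I_N -> R)
    (mu : {measure set (borelRd R d) -> \bar R}) rA i c :
  A = hrep v b -> (forall j, v j != 0) -> (forall x, A x -> `|x| <= rA) ->
  locally_finite mu -> conv_tiles A mu ->
  (forall m, (m < 4)%N -> 0 < dotv (u (m + i)) c) -> False.
Proof.
move=> AE v0 bA lf tA pos.
have c0 := pos 0%N isT; have c1 := pos 1%N isT; have c2 := pos 2%N isT; have c3 := pos 3%N isT.
have v_le j x : A x -> dotv (v j) x <= b j by rewrite AE; apply.
(* The value of [Q j] at [x] is that of [v j] on the point [l] of a moment curve in the directions
   of the subfacet; avoiding the roots ensures that [v j] annihilates [l] only if it lies in [W]. *)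
pose Q j : {poly R} := \poly_(m < (d.-2).+1) dotv (v j) (p (inord m) - p ord0).
have [x hx] : exists x, forall j, ~~ `[< W (v j) >] -> (Q j).[x] != 0.
  apply: exists_nonroots => j; apply: contra => /eqP Q0; apply/asboolP => m.
  by have := congr1 (fun f : {poly R} => f`_m) Q0; rewrite coef0 coef_poly ltn_ord inord_val.
pose l := \sum_(m < (d.-2).+1) x ^+ m *: (p m - p ord0).
have dl w : dotv w l = \sum_(m < (d.-2).+1) x ^+ m * dotv w (p m - p ord0).
  by rewrite dotv_sumr; apply: eq_bigr => m _; rewrite dotvZr.
have lW w : W w -> dotv w l = 0.
  by move=> Ww; rewrite dl big1// => m _; rewrite Ww mulr0.
have lW' j : dotv (v j) l = 0 -> W (v j).
  move=> l0; apply: contrapT => /asboolPn /hx/eqP; apply.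
  rewrite horner_poly -[RHS]l0 dl; apply: eq_bigr => m _.
  by rewrite inord_val mulrC.
have [q [s [s0 qG qE]]] := subfacet_points i.+1.
pose n : R := (d.-2).+1%:R.
have n0 : 0 < n by rewrite ltr0n.
(* At the barycentre of the points [q m], a constraint is active only if it is active at all of
   them, which puts it in [W]. *)
pose x0 := n^-1 *: \sum_m q m.
have d0 w : dotv w x0 = n^-1 * \sum_m dotv w (q m) by rewrite dotvZr dotv_sumr.
have avg w k : (forall m, dotv w (q m) = k) -> dotv w x0 = k.
  move=> wk; rewrite d0 (eq_bigr (fun=> k))// sumr_const card_ord -mulr_natl.
  by rewrite mulrA mulVf ?mul1r// gt_eqF.
have qA m : A (q m) by have [/FA] := qG m.
have Ax0 : A x0.
  rewrite AE => j; rewrite d0 ler_pdivrMl//.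
  apply: le_trans (ler_sum _ (fun m _ => v_le j _ (qA m))) _.
  by rewrite sumr_const card_ord -mulr_natl.
have act j : dotv (v j) x0 = b j -> exists al be : R,
    [/\ 0 <= al, 0 <= be & v j = al *: u i.+1 + be *: u i.+2].
  rewrite d0 => e.
  have e' : \sum_m (b j - dotv (v j) (q m)) = 0.
    by rewrite sumrB sumr_const card_ord -mulr_natl -e mulrA divff ?gt_eqF// mul1r subrr.
  have eq m : dotv (v j) (q m) = b j.
    apply/eqP; rewrite eq_sym -subr_eq0; apply/eqP.
    by apply: (psumr_eq0P _ e') => // m' _; rewrite subr_ge0 v_le.
  have Wv : W (v j).
    by move=> m; apply: (mulfI s0); rewrite mulr0 -dotvZr -qE dotvBr !eq subrr.
  have [al' [be' vE]] := span_consecutive i.+1 Wv.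
  exists al', be'.
  by have [] := active_coef_ge0 vE (v_le j) (qG ord0) (eq ord0).
have [y1 Fy1 y1lt] := facet_off_next i.+1; have [y2 Fy2 y2lt] := facet_off_prev i.+1.
have AE' : forall x, hrep v b x -> A x by rewrite AE.
apply: (@blowup_contradiction R d N v b mu t0 rA _ _ lf _ (u i.+1) (u i.+2) x0 l
  (y1 - y2) c (h i.+1) (h i.+2)) => //.
- by move=> x' /AE'/bA.
- by move=> x' /AE'/symA; rewrite AE.
- by rewrite -AE.
- by move=> x' /AE'; apply: u_le.
- by move=> x' /AE'; apply: u_le.
- by rewrite -AE.
- by apply: avg => m; apply: Fh; case: (qG m).
- by apply: avg => m; apply: Fh; case: (qG m).
- by apply: lW; apply: uW.
- by apply: lW; apply: uW.
- move=> j z /lW' Wv /AE' Az zF zb.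
  have at_end k : F k.+1 z -> 0 < dotv (u k) c -> 0 < dotv (u k.+1) c ->
      0 < dotv (u k.+2) c -> 0 < dotv (v j) c.
    move=> Fz p0 p1 p2.
    have [[g Gg ge]|[g Gg ge]] := active_at_end Wv (v_le j) Fz zb.
      exact: (active_pos Wv (v0 j) (v_le j) Gg ge).
    exact: (active_pos Wv (v0 j) (v_le j) Gg ge).
  case: zF => zh; [apply: (at_end i) => //|apply: (at_end i.+1) => //]; exact/FE.
- by rewrite dotvBr (Fh Fy1) subr_gt0.
- by rewrite dotvBr (Fh Fy2) subr_lt0.
Qed.

(** If [u i] and [u i.+2] are parallel for one [i], they are so for all, and [F i.+2] is the
    reflection of [F i]. Otherwise the premise forces [u i.+3] to be parallel to [u i], and [F i.+3]
    is the reflection of [F i]. Reflecting twice gives the period 4 or 6. *)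
Lemma belt_period :
  (forall i c, (forall k, (k < 4)%N -> 0 < dotv (u (k + i)) c) -> False) ->
  exists m : nat, (m = 4%N \/ m = 6%N) /\
      (forall i, F (i + m)%N = F i) /\
      (forall i j : nat, (i < j < m)%N -> F i <> F j).
Proof.
move=> no_pos.
have symK x : - t0 - (- t0 - x) = x by rewrite opprB addrC subrK.
have double n i k k' : multiple i (i + n) k -> k < 0 ->
    multiple (i + n) (i + n + n) k' -> k' < 0 -> F (i + n + n) = F i.
  move=> ik k0 ik' k'0; apply/seteqP; split=> x.
    by move=> /(antipodal_facet ik' k'0)/(antipodal_facet ik k0); rewrite symK.
  move=> Fx; apply/(antipodal_facet ik' k'0)/(antipodal_facet ik k0).
  by rewrite symK.
have all_i i : (om i i.+2 == 0) = (om 0 2 == 0).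
  by elim: i => // i <-; rewrite -om2_eq0_succ.
have [e2|e2] := eqVneq (om 0 2) 0.
  have m2 i : exists2 k, k < 0 & multiple i i.+2 k.
    by apply: multiple2; apply/eqP; rewrite all_i e2 ?eqxx.
  exists 4%N; split; [by left|split].
    move=> i; have [k k0 ik] := m2 i; have [k' k'0 ik'] := m2 i.+2.
    have := double 2%N i k k'; rewrite !addn2 => /(_ ik k0 ik' k'0).
    by move=> <-; rewrite !addnS !addn0.
  move=> i j /andP[ij j4].
  (* The gap is written [n.+1]; the gaps 1, 2, 3 are then excluded because the normals are either
     not parallel or opposite. *)
  have [n jE] : exists n, j = (n.+1 + i)%N.
    by exists (j - i).-1; rewrite prednK ?subn_gt0// subnK// ltnW.
  have : (n < 3)%N by rewrite jE in j4; move: j4; rewrite addSn ltnS; apply: leq_ltn_trans; rewrite leq_addr.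
  case: n jE => [|[|[|]]]// -> _.
  - by apply: neq_of_om; rewrite gt_eqF ?om_gt0.
  - by have [k k0 ik] := m2 i; apply: neq_of_neg ik k0.
  - have [k k0 ik] := m2 i.+1; apply: neq_of_om; rewrite (om_multipler _ ik).
    by rewrite mulf_eq0 negb_or (lt_eqF k0) (gt_eqF (om_gt0 i)).
have o2 i : 0 < om i i.+2 by rewrite lt_def om2_ge0 all_i e2.
have m3 i : exists2 k, k < 0 & multiple i i.+3 k.
  apply: multiple3 => //; apply/eqP; apply: contraT => n0; exfalso.
  have o3 : 0 < om i i.+3 by rewrite lt_def n0 om3_ge0.
  by have [c /no_pos] := common_positive (o2 i) o3.
exists 6%N; split; [by right|split].
  move=> i; have [k k0 ik] := m3 i; have [k' k'0 ik'] := m3 i.+3.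
  have := double 3%N i k k'; rewrite !addn3 => /(_ ik k0 ik' k'0) <-.
  by rewrite !addnS !addn0.
move=> i j /andP[ij j6].
have [n jE] : exists n, j = (n.+1 + i)%N.
  by exists (j - i).-1; rewrite prednK ?subn_gt0// subnK// ltnW.
have : (n < 5)%N by rewrite jE in j6; move: j6; rewrite addSn ltnS; apply: leq_ltn_trans; rewrite leq_addr.
case: n jE => [|[|[|[|[|]]]]]// -> _.
- by apply: neq_of_om; rewrite gt_eqF ?om_gt0.
- by apply: neq_of_om; rewrite gt_eqF.
- by have [k k0 ik] := m3 i; apply: neq_of_neg ik k0.
- have [k k0 ik] := m3 i.+1; apply: neq_of_om; rewrite (om_multipler _ ik).
  by rewrite mulf_eq0 negb_or (lt_eqF k0) (gt_eqF (om_gt0 i)).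
- have [k k0 ik] := m3 i.+2; apply: neq_of_om; rewrite (om_multipler _ ik).
  by rewrite mulf_eq0 negb_or (lt_eqF k0) (gt_eqF (o2 i)).
Qed.

End Belt.

Unset Implicit Arguments.
Set Strict Implicit.

Theorem theorem6p1 (R : realType) (d : nat) (A : set 'rV[R]_d)
    (mu : {measure set (borelRd R d) -> \bar R}) :
  (2 <= d)%N ->
  is_polytope A -> A° !=set0 ->
  centrally_symmetric A ->
  (forall F, facet A F -> centrally_symmetric F) ->
  locally_finite mu ->
  conv_tiles A mu ->
  forall F : nat -> set 'rV[R]_d, belt_seq A F ->
    exists m : nat, (m = 4%N \/ m = 6%N) /\
      (forall i, F (i + m)%N = F i) /\
      (forall i j : nat, (i < j < m)%N -> F i <> F j).
Proof.
move=> _ polyA intA [t0 symE] _ lf tA F [facetF [F01 [[_ [[p [p_in p_free]] _]] step]]].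
have A0 : A !=set0 by have [x /interior_subset Ax] := intA; exists x.
have [N [v [b [v0 AE]]]] := polytope_hrep polyA A0.
have [r rA] := polytope_bounded polyA.
have bA x : A x -> `|x| <= `|r|.
  by move=> Ax; apply: norm_le_coord => // i; apply: le_trans (rA _ Ax i) (ler_norm r).
have symA x : A x -> A (- t0 - x).
  (* Central symmetry writes [- x] as [y + t0] with [y] in [A], so the reflection of [A] sends [x]
     to [- t0 - x]. *)
  move=> Ax; have : [set - x | x in A] (- x) by exists x.
  by rewrite symE => -[y Ay yE]; rewrite -yE addrC addrK.
have /choice[uh uhP] : forall i, exists uh : 'rV[R]_d * R,
    [/\ uh.1 != 0, forall x, A x -> dotv uh.1 x <= uh.2 &
      forall x, F i x <-> A x /\ dotv uh.1 x = uh.2].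
  move=> i; have [/face_supporting[u [h uhP]] _] := facetF i.
  by exists (u, h).
have F_neq i : F i <> F i.+1.
  by case: i => // i; have [/nesym] := step i.
pose u i := (uh i).1; pose h i := (uh i).2.
have u_neq0 i : u i != 0 by have [] := uhP i.
have u_le i x : A x -> dotv (u i) x <= h i by have [_ + _] := uhP i; apply.
have FE i x : F i x <-> A x /\ dotv (u i) x = h i by have [_ _] := uhP i; apply.
have F_step i := (step i).2.
have [al [be uE]] := coord_exists intA u_neq0 u_le FE F_neq F_step p_in p_free.
apply: (belt_period intA facetF u_neq0 u_le FE F_neq F_step p_in uE symA).
move=> i c; exact: (no_common_positive intA facetF u_neq0 u_le FE F_neq F_step p_in p_free symA AE v0 bA lf tA).
Qed.
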